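(* Let $\mathcal{A}$ be an operator algebra which can be written as $\mathcal{A}=\bigoplus_{n=1}^\infty\mathcal{A}_n$, where $\mathcal{A}_n$ is a unital finite-dimensional operator algebra for each $n\in\mathbb{N}$. Then $C^*_{\max}(\mathcal{A})$ is RFD.
   Context: An operator algebra is a norm closed subalgebra of $B(\mathfrak{H})$, $\mathfrak{H}$ a complex Hilbert space; it is unital if it contains the identity on $\mathfrak{H}$. $\bigoplus_{n=1}^\infty\mathcal{A}_n$ is the $c_0$-direct sum: sequences $(a_n)_n$ with $a_n\in\mathcal{A}_n$ and $\|a_n\|\to0$, with the supremum norm, acting diagonally on the direct sum of the Hilbert spaces. A $C^*$-algebra is residually finite-dimensional (RFD) if it admits an injective $*$-homomorphism into a product $\prod_\lambda\mathbb{M}_{r_\lambda}$ of matrix algebras (bounded families, supremum norm). The maximal $C^*$-cover of $\mathcal{A}$ is the essentially unique pair $(C^*_{\max}(\mathcal{A}),\mu)$ where $C^*_{\max}(\mathcal{A})$ is a $C^*$-algebra and $\mu:\mathcal{A}\to C^*_{\max}(\mathcal{A})$ is a completely isometric homomorphism with $C^*(\mu(\mathcal{A}))=C^*_{\max}(\mathcal{A})$, such that for every completely contractive homomorphism $\phi:\mathcal{A}\to B(\mathfrak{H}_\phi)$ there is a $*$-homomorphism $\pi_\phi:C^*_{\max}(\mathcal{A})\to B(\mathfrak{H}_\phi)$ with $\pi_\phi\circ\mu=\phi$. *)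

(* Defs.v *)
From HB Require Import structures.
From mathcomp Require Import all_boot all_order all_algebra.
From mathcomp Require Import complex ring.
From mathcomp Require Import all_classical all_reals all_analysis.

Set Implicit Arguments.
Unset Strict Implicit.
Unset Printing Implicit Defensive.

Import Order.TTheory GRing.Theory Num.Theory.
Import numFieldNormedType.Exports.

Local Open Scope classical_set_scope.
Local Open Scope complex_scope.
Local Open Scope ring_scope.

HB.mixin Record isHilbert (R : realType) H & CompleteNormedModule R[i] H := {
  hdot : {dot H for @Num.conj R[i]} ;
  hdotE : forall x : H, hdot x x = `|x| ^+ 2
}.

(* Complex Hilbert spaces; hdot is linear in its first argument. *)
#[short(type="hilbertType")]
HB.structure Definition Hilbert (R : realType) :=
  {H of CompleteNormedModule R[i] H & isHilbert R H}.

(* The norm of a normed space over R[i] is R[i]-valued (with values in the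
   nonnegative reals); rnorm is the same norm as an element of R. *)
Definition rnorm (R : realType) (V : normedZmodType R[i]) (x : V) : R :=
  complex.Re `|x|.

Section DotCauchySchwarz.
Variables (C : numClosedFieldType) (U : lmodType C).
Variable form : {dot U for @Num.conj C}.

Lemma dot_CauchySchwarz (u v : U) :
  `|form u v| ^+ 2 <= form u u * form v v.
Proof.
have [->|v0] := eqVneq v 0; first by rewrite linear0r normr0 expr0n/= mulr_ge0 ?dnorm_ge0.
have vv : 0 < form v v by rewrite dnorm_gt0.
pose a := form u v / form v v; pose w := u - a *: v.
have wv : form w v = 0.
  by rewrite linearBl/= linearZl_LR/= divfK ?subrr// gt_eqF.
have -> : form u u = form w w + `|a| ^+ 2 * form v v.
  rewrite -dnormZ -[in LHS](subrK (a *: v) u) -/w hnormDd//=.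
  by rewrite linearZr_LR/= wv mulr0.
rewrite mulrDl; apply: (@le_trans _ _ (`|a| ^+ 2 * form v v * form v v)).
  rewrite -mulrA -expr2 -[X in _ * X ^+ 2]gtr0_norm// -exprMn -normrM.
  by rewrite divfK ?gt_eqF.
by rewrite lerDr mulr_ge0 ?dnorm_ge0.
Qed.

Lemma dot_triangle (u v : U) :
  sqrtC (form (u + v) (u + v)) <= sqrtC (form u u) + sqrtC (form v v).
Proof.
set a := sqrtC (form u u); set b := sqrtC (form v v).
have a0 : 0 <= a by rewrite sqrtC_ge0 dnorm_ge0.
have b0 : 0 <= b by rewrite sqrtC_ge0 dnorm_ge0.
rewrite -(@ler_pXn2r _ 2)// ?nnegrE ?sqrtC_ge0 ?dnorm_ge0 ?addr_ge0// sqrtCK.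
rewrite dnormD sqrrD /a /b !sqrtCK -/a -/b addrAC lerD2r lerD2l.
have cs : `|form u v| <= a * b.
  rewrite -(@ler_pXn2r _ 2)// ?nnegrE ?mulr_ge0// exprMn !sqrtCK.
  exact: dot_CauchySchwarz.
apply: (@le_trans _ _ `|form u v + (form u v)^*|%R).
  by apply: real_ler_norm; apply/CrealP; rewrite rmorphD /= conjCK addrC.
apply: (le_trans (ler_normD _ _)); rewrite norm_conjC -mulr2n.
by rewrite lerMn2r.
Qed.

End DotCauchySchwarz.
(* Series over a numFieldType, stated over an abstract field so that they can
   be instantiated at R[i], whose carrier has no registered topology. *)
Definition csum (K : numFieldType) (u : nat -> K) : K := limn (series u).

Definition summable_series (K : numFieldType) (u : nat -> K) : Prop :=
  cvgn (series u).

Section Series.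
Variable K : numClosedFieldType.
Implicit Types u v : nat -> K.

Lemma summable_seriesP u (l : K) :
  (forall e, 0 < e -> \forall n \near \oo, `|l - series u n| < e) ->
  summable_series u /\ csum u = l.
Proof.
move=> H; have ul : series u @ \oo --> l by apply/cvgrPdist_lt.
by split; [apply/cvg_ex; exists l | exact/cvg_lim].
Qed.

Lemma csumP u : summable_series u ->
  forall e, 0 < e -> \forall n \near \oo, `|csum u - series u n| < e.
Proof. by move=> cu; apply/cvgrPdist_lt. Qed.

Lemma csum_linear (a : K) u v : summable_series u -> summable_series v ->
  csum (fun n => a * u n + v n) = a * csum u + csum v.
Proof.
move=> cu cv; apply: cvg_lim => //.
rewrite (_ : series _ = (fun n => a * series u n + series v n)); last first.
  by apply/funext => n; rewrite !seriesEnat/= big_split/= mulr_sumr.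
by apply: cvgD => //; apply: cvgM => //; exact: cvg_cst.
Qed.

Lemma csum_conj u : summable_series u ->
  csum (fun n => Num.conj (u n)) = Num.conj (csum u).
Proof.
move=> cu; apply: cvg_lim => //; apply/cvgrPdist_lt => e e0.
have := csumP cu e0; apply: filterS => n.
rewrite (_ : series (fun k => Num.conj (u k)) n = Num.conj (series u n)).
  by rewrite -rmorphB norm_conjC.
by rewrite !seriesEnat/= rmorph_sum.
Qed.

End Series.

Section ComplexSeries.
Variable R : realType.

Lemma rnormE (V : normedZmodType R[i]) (x : V) : (rnorm x)%:C = `|x|.
Proof. by rewrite /rnorm RRe_real// normr_real. Qed.

Lemma rnorm_ge0 (V : normedZmodType R[i]) (x : V) : 0 <= rnorm x.
Proof. by rewrite -ler0c rnormE. Qed.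

Lemma gt0_complexP (e : R[i]) : 0 < e -> exists2 r : R, 0 < r & e = r%:C.
Proof.
move=> e0; exists (complex.Re e); last by rewrite RRe_real// gtr0_real.
by move: e0; rewrite ltcE => /andP[].
Qed.

Lemma normc_le_ReIm (z : R[i]) :
  `|z| <= (`|complex.Re z| + `|complex.Im z|)%:C.
Proof.
have nr (x : R) : `|x%:C| = `|x|%:C :> R[i].
  by rewrite normc_def /= expr0n/= addr0 sqrtr_sqr.
rewrite [X in `|X|]complexE (le_trans (ler_normD _ _))// normrM !nr.
have -> : `|'i%C| = 1 :> R[i] by rewrite normc_def/= expr0n expr1n add0r sqrtr1.
by rewrite mul1r -rmorphD.
Qed.

Lemma normc_ge_Im (z : R[i]) : `|complex.Im z|%:C <= `|z|.
Proof.
have -> : complex.Im z = - complex.Re (z * 'i%C) by rewrite ReiNIm opprK.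
rewrite normrN (le_trans (normc_ge_Re _))// normrM.
by rewrite [`|'i%C|]normc_def/= expr0n expr1n add0r sqrtr1 mulr1.
Qed.

Lemma Re_sum (u : nat -> R[i]) n :
  complex.Re (series u n) = series (fun n => complex.Re (u n)) n.
Proof. by rewrite !seriesEnat/= (raddf_sum (@complex.Re R : {additive Rcomplex R -> R})). Qed.

Lemma Im_sum (u : nat -> R[i]) n :
  complex.Im (series u n) = series (fun n => complex.Im (u n)) n.
Proof. by rewrite !seriesEnat/= (raddf_sum (@complex.Im R : {additive Rcomplex R -> R})). Qed.

Lemma cvg_complex (u : nat -> R[i]) (a b : R) :
  series (fun n => complex.Re (u n)) @ \oo --> a ->
  series (fun n => complex.Im (u n)) @ \oo --> b ->
  summable_series u /\ csum u = a +i* b.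
Proof.
move=> ua ub; apply: summable_seriesP => _ /gt0_complexP[r r0 ->].
have r20 : 0 < r / 2 by rewrite divr_gt0.
move/cvgrPdist_lt : ua => /(_ _ r20) ua; move/cvgrPdist_lt : ub => /(_ _ r20) ub.
near=> n.
rewrite (le_lt_trans (normc_le_ReIm _))// ltcR [ltRHS]splitr ltrD//.
  have -> : complex.Re (a +i* b - series u n) = a - complex.Re (series u n).
    by case: (series u n).
  by rewrite Re_sum; near: n.
have -> : complex.Im (a +i* b - series u n) = b - complex.Im (series u n).
  by case: (series u n).
by rewrite Im_sum; near: n.
Unshelve. all: by end_near. Qed.

Lemma csum_real (u : nat -> R) : cvgn (series u) ->
  csum (fun n => (u n)%:C) = (limn (series u))%:C.
Proof.
move=> cu; have [//|_ ->//] := @cvg_complex (fun n => (u n)%:C) (limn (series u)) 0 cu.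
rewrite (_ : series _ = fun=> 0); first exact: cvg_cst.
by apply/funext => n; rewrite seriesEnat/= big1.
Qed.

(* Absolutely convergent complex series converge. *)
Lemma summable_series_le (u : nat -> R[i]) (v : nat -> R) :
  (forall n, `|u n| <= (v n)%:C) -> cvgn (series v) -> summable_series u.
Proof.
move=> uv cv.
have H (w : nat -> R) : (forall n, `|w n|%:C <= `|u n|) -> cvgn (series w).
  move=> wu; apply: normed_cvg; apply: series_le_cvg cv => //= n.
    by rewrite (@le_trans _ _ `|w n|)// -lecR (le_trans (wu n)).
  by rewrite -lecR (le_trans (wu n)).
have cR := H _ (fun n => normc_ge_Re (u n)).
have cI := H _ (fun n => normc_ge_Im (u n)).
by have [] := cvg_complex cR cI.
Qed.

End ComplexSeries.
Section L2Sum.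
Variables (R : realType) (H_ : nat -> hilbertType R).

(* The Hilbert space direct sum of the H_ n: square summable sequences. *)
Record l2sum := L2Sum {
  l2val :> forall n, H_ n ;
  l2valP : cvgn (series (fun n => rnorm (l2val n) ^+ 2))
}.

Arguments l2valP : clear implicits.

Lemma l2sum_ext (x y : l2sum) : (forall n, x n = y n) -> x = y.
Proof.
case: x y => [x xP] [y yP] /= xy.
have {}xy : x = y by exact: functional_extensionality_dep.
by subst y; congr L2Sum; exact: Prop_irrelevance.
Qed.

HB.instance Definition _ := gen_eqMixin l2sum.
HB.instance Definition _ := gen_choiceMixin l2sum.

Lemma l2_lin (a : R[i]) (x y : l2sum) :
  cvgn (series (fun n => rnorm (a *: x n + y n) ^+ 2)).
Proof.
have cv : cvgn (series (fun n => 2 * rnorm a ^+ 2 * rnorm (x n) ^+ 2 +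
                                 2 * rnorm (y n) ^+ 2)).
  exact: is_cvg_seriesD (is_cvg_seriesZ (l2valP x)) (is_cvg_seriesZ (l2valP y)).
apply: series_le_cvg cv => n /=; first exact: sqr_ge0.
  by rewrite addr_ge0// !mulr_ge0// ?exprn_ge0// rnorm_ge0.
have h : rnorm (a *: x n + y n) <= rnorm a * rnorm (x n) + rnorm (y n).
  rewrite -lecR rmorphD rmorphM/= !rnormE (le_trans (ler_normD _ _))//.
  by rewrite normrZ.
apply: (@le_trans _ _ ((rnorm a * rnorm (x n) + rnorm (y n)) ^+ 2)).
  by rewrite lerXn2r// ?nnegrE ?addr_ge0 ?mulr_ge0 ?rnorm_ge0.
rewrite -subr_ge0.
have -> : 2 * rnorm a ^+ 2 * rnorm (x n) ^+ 2 + 2 * rnorm (y n) ^+ 2 -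
  (rnorm a * rnorm (x n) + rnorm (y n)) ^+ 2 =
  (rnorm a * rnorm (x n) - rnorm (y n)) ^+ 2 by ring.
exact: sqr_ge0.
Qed.

Arguments l2_lin : clear implicits.

Lemma l2_zeroP : cvgn (series (fun n => rnorm (0 : H_ n) ^+ 2)).
Proof.
rewrite (_ : series _ = fun=> 0); first exact: is_cvg_cst.
apply/funext => n; rewrite seriesEnat/= big1// => i _.
by rewrite /rnorm normr0/= expr0n.
Qed.

Definition l2_zero := L2Sum l2_zeroP.

Definition l2_axpy (a : R[i]) (x y : l2sum) := L2Sum (l2_lin a x y).

Definition l2_add (x y : l2sum) : l2sum := l2_axpy 1 x y.
Definition l2_opp (x : l2sum) : l2sum := l2_axpy (-1) x l2_zero.
Definition l2_scale (a : R[i]) (x : l2sum) : l2sum := l2_axpy a x l2_zero.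

Lemma l2_addA : associative l2_add.
Proof. by move=> x y z; apply: l2sum_ext => n /=; rewrite !scale1r addrA. Qed.
Lemma l2_addC : commutative l2_add.
Proof. by move=> x y; apply: l2sum_ext => n /=; rewrite !scale1r addrC. Qed.
Lemma l2_add0 : left_id l2_zero l2_add.
Proof. by move=> x; apply: l2sum_ext => n /=; rewrite scale1r add0r. Qed.
Lemma l2_addN : left_inverse l2_zero l2_opp l2_add.
Proof.
by move=> x; apply: l2sum_ext => n /=; rewrite scale1r scaleN1r addr0 addNr.
Qed.

HB.instance Definition _ :=
  GRing.isZmodule.Build l2sum l2_addA l2_addC l2_add0 l2_addN.

Lemma l2_addE (x y : l2sum) n : (x + y) n = x n + y n.
Proof. by rewrite /= scale1r. Qed.
Lemma l2_oppE (x : l2sum) n : (- x) n = - x n.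
Proof. by rewrite /= scaleN1r addr0. Qed.
Lemma l2_scale_subproof (a : R[i]) (x : l2sum) n : l2_scale a x n = a *: x n.
Proof. by rewrite /= addr0. Qed.

Lemma l2_scaleA (a b : R[i]) (x : l2sum) :
  l2_scale a (l2_scale b x) = l2_scale (a * b) x.
Proof. by apply: l2sum_ext => n; rewrite !l2_scale_subproof scalerA. Qed.
Lemma l2_scale1 : left_id 1 l2_scale.
Proof. by move=> x; apply: l2sum_ext => n; rewrite l2_scale_subproof scale1r. Qed.
Lemma l2_scaleDr : right_distributive l2_scale +%R.
Proof.
move=> a x y; apply: l2sum_ext => n.
by rewrite l2_addE !l2_scale_subproof l2_addE scalerDr.
Qed.
Lemma l2_scaleDl (x : l2sum) : {morph l2_scale^~ x : a b / a + b}.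
Proof.
move=> a b; apply: l2sum_ext => n.
by rewrite l2_addE !l2_scale_subproof scalerDl.
Qed.

HB.instance Definition _ := GRing.Zmodule_isLmodule.Build R[i] l2sum
  l2_scaleA l2_scale1 l2_scaleDr l2_scaleDl.

Lemma l2_scaleE (a : R[i]) (x : l2sum) n : (a *: x) n = a *: x n.
Proof. exact: l2_scale_subproof. Qed.

Definition l2dot (x y : l2sum) : R[i] := csum (fun n => hdot (x n) (y n)).

Lemma l2dot_summable (x y : l2sum) :
  summable_series (fun n => hdot (x n) (y n)).
Proof.
apply: (@summable_series_le _ _ (fun n => rnorm (x n) ^+ 2 + rnorm (y n) ^+ 2)).
  move=> n; have : `|hdot (x n) (y n)| ^+ 2 <= (`|x n| * `|y n|) ^+ 2.
    by rewrite exprMn -!hdotE; exact: dot_CauchySchwarz.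
  rewrite ler_pXn2r// ?nnegrE ?mulr_ge0// => /le_trans; apply.
  rewrite -!rnormE -rmorphM lecR -subr_ge0.
  set a := rnorm _; set b := rnorm _.
  have -> : a ^+ 2 + b ^+ 2 - a * b =
    ((a - b) ^+ 2 + a ^+ 2 + b ^+ 2) / 2 by field.
  by rewrite divr_ge0// !addr_ge0// sqr_ge0.
exact: is_cvg_seriesD (l2valP x) (l2valP y).
Qed.

Lemma l2dot_conj (x y : l2sum) : l2dot x y = Num.conj (l2dot y x).
Proof.
rewrite /l2dot -csum_conj; last exact: l2dot_summable.
by congr csum; apply/funext => n; rewrite hermC/= expr0 mul1r.
Qed.

Lemma l2dot_linl (a : R[i]) (x y z : l2sum) :
  l2dot (a *: x + y) z = a * l2dot x z + l2dot y z.
Proof.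
rewrite /l2dot -csum_linear; try exact: l2dot_summable.
congr csum; apply/funext => n.
by rewrite l2_addE l2_scaleE linearDl/= linearZl_LR.
Qed.

Lemma l2dot_linr (a : R[i]) (x y z : l2sum) :
  l2dot z (a *: x + y) = Num.conj a * l2dot z x + l2dot z y.
Proof. by rewrite l2dot_conj l2dot_linl rmorphD rmorphM/= -!l2dot_conj. Qed.

Lemma l2dot_bilinear :
  bilinear_for ( *%R : GRing.Scale.law R[i] R[i])
    (@Num.conj R[i] \; *%R : GRing.Scale.law R[i] R[i]) l2dot.
Proof.
split=> [z a x y|z a x y]; first by rewrite /= l2dot_linl.
by rewrite /= l2dot_linr.
Qed.

HB.instance Definition _ := bilinear_isBilinear.Build R[i] l2sum l2sum R[i]
  ( *%R) (@Num.conj R[i] \; *%R) l2dot l2dot_bilinear.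

Lemma l2dot_herm (x y : l2sum) : l2dot x y = (-1) ^+ false * Num.conj (l2dot y x).
Proof. by rewrite expr0 mul1r -l2dot_conj. Qed.

HB.instance Definition _ :=
  isHermitianSesquilinear.Build R[i] l2sum false (@Num.conj R[i]) l2dot l2dot_herm.

Lemma l2dotxx (x : l2sum) :
  l2dot x x = (limn (series (fun n => rnorm (x n) ^+ 2)))%:C.
Proof.
rewrite -(csum_real (l2valP x)); congr csum; apply/funext => n.
by rewrite hdotE -rnormE -rmorphXn.
Qed.

Lemma l2_partial_le (x : l2sum) N :
  \sum_(0 <= n < N) rnorm (x n) ^+ 2 <= limn (series (fun n => rnorm (x n) ^+ 2)).
Proof.
have := nondecreasing_cvgn_le _ (l2valP x) N; rewrite seriesEnat; apply.
by apply: nondecreasing_series => n _; rewrite sqr_ge0.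
Qed.

Lemma l2dot_gt0 (x : l2sum) : x != 0 -> 0 < l2dot x x.
Proof.
move=> x0; rewrite l2dotxx ltcR lt_neqAle; apply/andP; split; last first.
  by have := l2_partial_le x 0; rewrite big_geq.
apply: contra x0 => /eqP l0; apply/eqP/l2sum_ext => n.
have := l2_partial_le x n.+1; rewrite -l0 big_nat_recr//= => h.
have : rnorm (x n) ^+ 2 <= 0.
  by rewrite (le_trans _ h)// lerDr sumr_ge0// => i _; rewrite sqr_ge0.
rewrite real_exprn_even_le0 ?num_real//= => /eqP xn0.
by apply/eqP; rewrite -normr_eq0 -rnormE xn0.
Qed.

HB.instance Definition _ := isDotProduct.Build R[i] l2sum l2dot l2dot_gt0.

Definition l2norm (x : l2sum) : R[i] := sqrtC (l2dot x x).

Lemma l2_normD (x y : l2sum) : l2norm (x + y) <= l2norm x + l2norm y.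
Proof. exact: (dot_triangle l2dot). Qed.

Lemma l2_normZ (a : R[i]) (x : l2sum) : l2norm (a *: x) = `|a| * l2norm x.
Proof.
rewrite /l2norm (dnormZ l2dot) sqrtCM ?nnegrE ?exprn_ge0// ?dnorm_ge0//.
by rewrite sqrCK.
Qed.

Lemma l2_norm0_eq0 (x : l2sum) : l2norm x = 0 -> x = 0.
Proof. by move/eqP; rewrite sqrtC_eq0 (dnorm_eq0 l2dot) => /eqP. Qed.

HB.instance Definition _ := Lmodule_isNormed.Build R[i] l2sum
  l2_normD l2_normZ l2_norm0_eq0.

Lemma l2_normE (x : l2sum) : `|x| = sqrtC (l2dot x x). Proof. by []. Qed.

Lemma l2_norm_sq (x : l2sum) : l2dot x x = `|x| ^+ 2.
Proof. by rewrite l2_normE sqrtCK. Qed.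

Lemma l2_rnorm_sq (x : l2sum) :
  rnorm x ^+ 2 = limn (series (fun n => rnorm (x n) ^+ 2)).
Proof. by apply: complexI; rewrite rmorphXn/= rnormE -l2_norm_sq l2dotxx. Qed.

Lemma l2_coord_le (x : l2sum) n : `|x n| <= `|x|.
Proof.
rewrite -!rnormE lecR -(@ler_pXn2r _ 2)// ?nnegrE ?rnorm_ge0// l2_rnorm_sq.
apply: le_trans (l2_partial_le x n.+1).
by rewrite big_nat_recr//= lerDr sumr_ge0// => i _; rewrite sqr_ge0.
Qed.

Lemma l2_cvg_coord (F : set_system l2sum) (n : nat) :
  ProperFilter F -> cauchy F -> cvg ((fun x : l2sum => x n) @ F).
Proof.
move=> FF /cauchy_ballP Fc; apply: cauchy_cvg; apply/cauchy_ballP => e e0.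
have [[A B]/= [FA FB] AB] := Fc e e0.
exists ((fun x : l2sum => x n) @` A, (fun x : l2sum => x n) @` B) => /=.
  split; [apply: filterS FA | apply: filterS FB] => x Ax /=; by exists x.
move=> [_ _] /= [[x Ax <-] [y By <-]].
have := AB (x, y) (conj Ax By); rewrite -!ball_normE/=; apply: le_lt_trans.
by have := l2_coord_le (x - y) n; rewrite l2_addE l2_oppE.
Qed.

Lemma l2_complete (F : set_system l2sum) :
  ProperFilter F -> cauchy F -> cvg F.
Proof.
move=> FF Fc.
pose l n : H_ n := lim ((fun x : l2sum => x n) @ F).
have Fl n : (fun x : l2sum => x n) @ F --> l n := l2_cvg_coord FF Fc.
have sumcvg (u : l2sum) N :
    (fun v : l2sum => \sum_(0 <= n < N) rnorm (u n - v n) ^+ 2) @ F -->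
    \sum_(0 <= n < N) rnorm (u n - l n) ^+ 2.
  elim: N => [|n IH].
    by under eq_fun do rewrite big_geq//; rewrite big_geq//; exact: cvg_cst.
  under eq_fun do rewrite big_nat_recr//=; rewrite big_nat_recr//=.
  apply: cvgD IH _.
  have h : (fun v : l2sum => rnorm (u n - v n)) @ F --> rnorm (u n - l n).
    apply/cvgrPdist_lt => e e0.
    have /cvgrPdist_lt/(_ e%:C) := Fl n; rewrite ltcR => /(_ e0).
    apply: filterS => v; rewrite -ltcR; apply: le_lt_trans.
    have nr (x : R) : `|x|%:C = `|x%:C| :> R[i].
      by rewrite normc_def /= expr0n/= addr0 sqrtr_sqr.
    rewrite nr rmorphB/= !rnormE (le_trans (ler_dist_dist _ _))//.
    by rewrite opprB addrC addrA subrK distrC.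
  exact: cvgM.
have key (e : R) : 0 < e -> F [set u : l2sum | forall N : nat,
    \sum_(0 <= n < N) rnorm (u n - l n) ^+ 2 <= e ^+ 2].
  move=> e0; have e0' : 0 < e%:C :> R[i] by rewrite ltcR.
  have /cauchy_ballP/(_ _ e0')[[A B]/= [FA FB] AB] := Fc.
  apply: filterS FA => u Au N; rewrite leNgt; apply/negP => lt.
  have /cvgr_gt/(_ _ lt) gtF := sumcvg u N.
  have [v [Bv]] := filter_ex (filterI FB gtF); apply/negP; rewrite -leNgt.
  have /= := AB (u, v) (conj Au Bv); rewrite -ball_normE/= => uv.
  apply: (@le_trans _ _ (rnorm (u - v) ^+ 2)).
    rewrite l2_rnorm_sq; apply: le_trans (l2_partial_le (u - v) N).
    rewrite [leLHS](_ : _ = \sum_(0 <= n < N) rnorm ((u - v) n) ^+ 2)//.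
    by apply: eq_bigr => n _; rewrite l2_addE l2_oppE.
  rewrite lerXn2r// ?nnegrE ?rnorm_ge0// ?ltW//.
  by rewrite -ltcR rnormE.
have bcvg (w : forall n, H_ n) (c : R) :
    (forall N, \sum_(0 <= n < N) rnorm (w n) ^+ 2 <= c) ->
    cvgn (series (fun n => rnorm (w n) ^+ 2)).
  move=> wc; apply: nondecreasing_is_cvgn.
    by apply: nondecreasing_series => n _; rewrite sqr_ge0.
  by exists c => _ [n _ <-]; rewrite seriesEnat; exact: wc.
have [u0 u0l] := filter_ex (key 1 ltr01).
pose d0 := L2Sum (bcvg (fun n => u0 n - l n) _ u0l).
have lE n : (u0 - d0) n = l n by rewrite l2_addE l2_oppE/= opprB addrC subrK.
apply/cvg_ex; exists (u0 - d0); apply/cvgrPdist_le => e /gt0_complexP[r r0 ->].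
apply: filterS (key r r0) => u ul; rewrite -rnormE lecR.
rewrite -(@ler_pXn2r _ 2)// ?nnegrE ?rnorm_ge0 ?(ltW r0)// l2_rnorm_sq.
apply: limr_le; first exact: l2valP.
apply: nearW => N; rewrite seriesEnat/=.
apply: le_trans (ul N); apply: ler_sum => n _.
suff -> : rnorm ((u0 - d0 - u) n) = rnorm (u n - l n) by [].
by apply: complexI; rewrite !rnormE l2_addE lE l2_oppE distrC.
Qed.

HB.instance Definition _ := Uniform_isComplete.Build l2sum l2_complete.

HB.instance Definition _ := isHilbert.Build R l2sum l2_norm_sq.

End L2Sum.
Section OperatorAlgebras.
Variable R : realType.
Implicit Types H K : hilbertType R.

Definition bounded_op H : set (H -> H) :=
  [set T | linear T /\ exists c : R, forall x, rnorm (T x) <= c * rnorm x].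

Arguments bounded_op : clear implicits.

Definition opnorm H (T : H -> H) : R :=
  sup [set rnorm (T x) | x in [set x : H | rnorm x <= 1]].

(* The norm of a matrix of operators, as an operator on the n-fold direct sum
   of H with itself. *)
Definition mx_opnorm H n (T : 'M[H -> H]_n) : R :=
  sup [set Num.sqrt (\sum_i rnorm (\sum_j T i j (x j)) ^+ 2)
      | x in [set x : 'I_n -> H | \sum_j rnorm (x j) ^+ 2 <= 1]].

Record operator_algebra H (A : set (H -> H)) : Prop := {
  opalg_bounded : A `<=` bounded_op H ;
  opalg0 : A 0 ;
  opalgD : forall S T, A S -> A T -> A (S + T) ;
  opalgZ : forall (c : R[i]) T, A T -> A (c *: T) ;
  opalgM : forall S T, A S -> A T -> A (S \o T) ;
  opalg_closed : forall T, bounded_op H T ->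
    (forall e : R, 0 < e -> exists2 S, A S & opnorm (T - S) < e) -> A T
}.

Definition unital_opalg H (A : set (H -> H)) : Prop := A idfun.

Definition finite_dimensional H (A : set (H -> H)) : Prop :=
  exists n (b : 'I_n -> (H -> H)), (forall i, A (b i)) /\
    forall T, A T -> exists c : 'I_n -> R[i], T = \sum_i c i *: b i.

(* Maps between algebras of operators are total functions on operators, of
   which only the values on the domain A matter. *)
Record alg_hom H K (A : set (H -> H)) (B : set (K -> K))
    (phi : (H -> H) -> (K -> K)) : Prop := {
  alg_hom_fun : forall T, A T -> B (phi T) ;
  alg_homD : forall S T, A S -> A T -> phi (S + T) = phi S + phi T ;
  alg_homZ : forall (c : R[i]) T, A T -> phi (c *: T) = c *: phi T ;
  alg_homM : forall S T, A S -> A T -> phi (S \o T) = phi S \o phi T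
}.

Definition completely_contractive H K (A : set (H -> H))
    (phi : (H -> H) -> (K -> K)) : Prop :=
  forall n (T : 'M[H -> H]_n), (forall i j, A (T i j)) ->
    mx_opnorm (map_mx phi T) <= mx_opnorm T.

Definition completely_isometric H K (A : set (H -> H))
    (phi : (H -> H) -> (K -> K)) : Prop :=
  forall n (T : 'M[H -> H]_n), (forall i j, A (T i j)) ->
    mx_opnorm (map_mx phi T) = mx_opnorm T.

Definition completely_isometrically_isomorphic H K
    (A : set (H -> H)) (B : set (K -> K)) : Prop :=
  exists phi, [/\ alg_hom A B phi, completely_isometric A phi & phi @` A = B].

(* The c_0-direct sum: the operators on the Hilbert space direct sum that act
   diagonally by some (a_n)_n with a_n in A_n and ||a_n|| -> 0. *)
Definition c0_sum (H_ : nat -> hilbertType R)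
    (A_ : forall n, set (H_ n -> H_ n)) : set (l2sum H_ -> l2sum H_) :=
  [set T | exists a : forall n, H_ n -> H_ n,
    [/\ forall n, A_ n (a n),
        (fun n => opnorm (a n)) @ \oo --> (0 : R) &
        forall (x : l2sum H_) n, T x n = a n (x n)]].

Definition hadjoint H (S T : H -> H) : Prop :=
  forall x y, hdot (S x) y = hdot x (T y).

(* Concrete C*-algebras: self-adjoint norm closed subalgebras of B(H). *)
Record cstar_algebra H (C : set (H -> H)) : Prop := {
  cstar_opalg : operator_algebra C ;
  cstar_adj : forall S, C S -> exists2 T, C T & hadjoint S T
}.

Record star_hom H K (C : set (H -> H)) (B : set (K -> K))
    (phi : (H -> H) -> (K -> K)) : Prop := {
  star_hom_alg : alg_hom C B phi ;
  star_hom_adj : forall S T, C S -> C T -> hadjoint S T ->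
    hadjoint (phi S) (phi T)
}.

(* (K, C, mu) is a maximal C*-cover of A; this determines (C, mu) up to a
   *-isomorphism. *)
Record maximal_cstar_cover H K (A : set (H -> H)) (mu : (H -> H) -> (K -> K))
    (C : set (K -> K)) : Prop := {
  cover_cstar : cstar_algebra C ;
  cover_hom : alg_hom A C mu ;
  cover_isometric : completely_isometric A mu ;
  cover_generated : smallest (@cstar_algebra K) (mu @` A) = C ;
  cover_universal : forall (L : hilbertType R) (phi : (H -> H) -> (L -> L)),
    alg_hom A (bounded_op L) phi -> completely_contractive A phi ->
    exists2 pi, star_hom C (bounded_op L) pi &
      forall T, A T -> pi (mu T) = phi T
}.

(* The C*-norm of a matrix, i.e., its norm as an operator on the Hilbert space
   R[i]^n. *)
Definition matrix_cstar_norm n (M : 'M[R[i]]_n) : R :=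
  sup [set Num.sqrt (\sum_i rnorm ((M *m x) i 0) ^+ 2)
      | x in [set x : 'cV[R[i]]_n | \sum_i rnorm (x i 0) ^+ 2 <= 1]].

(* A *-homomorphism from C into the algebra of bounded families of matrices. *)
Record matrix_star_hom K (C : set (K -> K)) (I : Type) (r : I -> nat)
    (pi : (K -> K) -> forall l, 'M[R[i]]_(r l)) : Prop := {
  matrix_hom_bounded : forall T, C T ->
    exists c : R, forall l, matrix_cstar_norm (pi T l) <= c ;
  matrix_homD : forall S T, C S -> C T -> forall l,
    pi (S + T) l = pi S l + pi T l ;
  matrix_homZ : forall (c : R[i]) T, C T -> forall l,
    pi (c *: T) l = c *: pi T l ;
  matrix_homM : forall S T, C S -> C T -> forall l,
    pi (S \o T) l = pi S l *m pi T l ;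
  matrix_hom_adj : forall S T, C S -> C T -> hadjoint S T -> forall l,
    pi T l = map_mx (@Num.conj R[i]) (pi S l)^T
}.

Definition residually_finite_dimensional K (C : set (K -> K)) : Prop :=
  exists (I : Type) (r : I -> nat)
    (pi : (K -> K) -> forall l, 'M[R[i]]_(r l)),
    [/\ forall l, (0 < r l)%N, matrix_star_hom C pi &
        forall S T, C S -> C T -> pi S = pi T -> S = T].

End OperatorAlgebras.

Arguments bounded_op {R} H _.

(* Main.v *)
(* For an orthonormal basis of a finite-dimensional mu(A)-invariant subspace X
   with orthogonal projection P, the map a |-> mu(a) P is a completely
   contractive homomorphism, so it extends to a *-homomorphism pi_X of C.
   As X increases, mu(a) P -> mu(a) and (mu(a) P)^* = P mu(a)^* -> mu(a)^*
   strongly, hence pi_X(T) -> T strongly for every T in C; the pi_X thus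
   separate the points of C, and they act on the finite-dimensional spaces X.
   There are enough such X: the unit of A_1 + ... + A_n is mapped by mu to a contractive
   idempotent q_n, i.e., to a projection, which is central in C; every vector x
   in the range of q_n has a finite-dimensional orbit
   mu(A)x = mu(A_1 + ... + A_n)x; and T q_n -> T in norm for every T in C. *)
Require Import Defs.
From HB Require Import structures.
From mathcomp Require Import all_boot all_order all_algebra.
From mathcomp Require Import complex ring lra.
From mathcomp Require Import all_classical all_reals all_analysis.

Set Implicit Arguments.
Unset Strict Implicit.
Unset Printing Implicit Defensive.

Import Order.TTheory GRing.Theory Num.Theory.
Import numFieldNormedType.Exports.

Local Open Scope classical_set_scope.
Local Open Scope complex_scope.
Local Open Scope ring_scope.

(** * Real-valued norms *)

Section RealNorm.
Variables (R : realType) (V : normedZmodType R[i]).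
Implicit Types x y : V.

Lemma rnorm0 : rnorm (0 : V) = 0.
Proof. by rewrite /rnorm normr0. Qed.

Lemma rnorm_eq0 x : rnorm x = 0 -> x = 0.
Proof. by move=> x0; apply/eqP; rewrite -normr_eq0 -rnormE x0. Qed.

Lemma ler_rnormD x y : rnorm (x + y) <= rnorm x + rnorm y.
Proof. by rewrite -lecR rmorphD/= !rnormE ler_normD. Qed.

Lemma rnormN x : rnorm (- x) = rnorm x.
Proof. by rewrite /rnorm normrN. Qed.

Lemma rdistC x y : rnorm (x - y) = rnorm (y - x).
Proof. by rewrite /rnorm distrC. Qed.

Lemma ler_rdistD z x y : rnorm (x - y) <= rnorm (x - z) + rnorm (z - y).
Proof. by rewrite -[x - y](subrKA z) ler_rnormD. Qed.

Lemma ler_rnorm_sum n (f : 'I_n -> V) :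
  rnorm (\sum_i f i) <= \sum_i rnorm (f i).
Proof.
elim/big_ind2 : _ => [|x1 x2 y1 y2 h1 h2|//]; first by rewrite rnorm0.
by rewrite (le_trans (ler_rnormD _ _))// lerD.
Qed.

(** Identities pass to norm limits through this estimate. The sign of [c] is free, so the hypothesis
    is applied to [e] divided by one plus the modulus of [c]. *)
Lemma rnorm_small (c : R) x :
  (forall e, 0 < e -> rnorm x <= e * c) -> x = 0.
Proof.
move=> h; apply: rnorm_eq0; apply/eqP; rewrite eq_le rnorm_ge0 andbT.
apply/ler_addgt0Pr => e e0; rewrite add0r.
have c0 : 0 < `|c| + 1 by rewrite ltr_wpDl.
apply: (le_trans (h (e / (`|c| + 1)) (divr_gt0 e0 c0))).
by rewrite mulrAC ler_pdivrMr// ler_pM2l// (le_trans (ler_norm c))// lerDl ler01.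
Qed.

End RealNorm.

Lemma rnorm_real (R : realType) (c : R) : rnorm (c%:C : R[i]) = `|c|.
Proof. by rewrite /rnorm normc_def/= expr0n/= addr0 sqrtr_sqr. Qed.

Lemma rnormZ (R : realType) (V : normedModType R[i]) (a : R[i]) (x : V) :
  rnorm (a *: x) = rnorm a * rnorm x.
Proof. by apply: complexI; rewrite rmorphM/= !rnormE normrZ. Qed.

(** * Cauchy sequences with an explicit rate *)

Section Completeness.
Variables (R : realType) (V : completeNormedModType R[i]).

(** The rate survives in the limit: through a late term [u k] with [k] past [n], the distance from
    [l] to [u n] is at most [e + b n] for every [e]. *)
Lemma complete_seq (u : nat -> V) (b : nat -> R) :
  (forall n m, (n <= m)%N -> rnorm (u m - u n) <= b n) ->
  (forall e, 0 < e -> exists n, b n < e) ->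
  exists l, forall n, rnorm (l - u n) <= b n.
Proof.
move=> ub b0.
have uc : cauchy (u @ \oo).
  apply: cauchy_exP => _ /gt0_complexP[e e0 ->].
  have [n bn] := b0 _ e0; exists (u n); exists n => // m /= nm.
  rewrite -ball_normE/= -rnormE ltcR rdistC.
  exact: le_lt_trans (ub _ _ nm) bn.
have /cvg_ex[l ul] : cvg (u @ \oo) by exact: cauchy_cvg.
exists l => n; apply/ler_addgt0Pl => e e0.
have eC : (0 : R[i]) < e%:C by rewrite ltcR.
move/cvgrPdist_lt : ul => /(_ _ eC)[m _ hm].
pose k := maxn m n.
have := hm k (leq_maxl _ _); rewrite /= -rnormE ltcR => lk.
apply: (le_trans (ler_rdistD (u k) _ _)); apply: lerD; first exact: ltW.
exact/ub/leq_maxr.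
Qed.

End Completeness.

(** * Adjoints and operator bounds on a Hilbert space *)

Section HilbertSpace.
Variables (R : realType) (H : hilbertType R).
Implicit Types x y z : H.

Lemma hdotDl x y z : hdot (x + y) z = hdot x z + hdot y z.
Proof. exact: linearDl. Qed.
Lemma hdotDr x y z : hdot z (x + y) = hdot z x + hdot z y.
Proof. exact: linearDr. Qed.
Lemma hdotBl x y z : hdot (x - y) z = hdot x z - hdot y z.
Proof. exact: linearBl. Qed.
Lemma hdotBr x y z : hdot z (x - y) = hdot z x - hdot z y.
Proof. exact: linearBr. Qed.
Lemma hdotZl a x z : hdot (a *: x) z = a * hdot x z.
Proof. by rewrite linearZl_LR. Qed.
Lemma hdotZr a x z : hdot z (a *: x) = Num.conj a * hdot z x.
Proof. by rewrite linearZr_LR. Qed.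
Lemma hdot0l z : hdot 0 z = 0.
Proof. exact: linear0l. Qed.

Lemma hdot0r z : hdot z 0 = 0.
Proof. exact: linear0r. Qed.

Lemma hdotC x y : hdot x y = Num.conj (hdot y x).
Proof. by rewrite hermC/= expr0 mul1r. Qed.

Lemma hdot_suml n (f : 'I_n -> H) z :
  hdot (\sum_i f i) z = \sum_i hdot (f i) z.
Proof. exact: (raddf_sum (applyr (@hdot R H) z)). Qed.

Lemma hdot_sumr n (f : 'I_n -> H) z :
  hdot z (\sum_i f i) = \sum_i hdot z (f i).
Proof. exact: (raddf_sum (@hdot R H z)). Qed.

Lemma hdotxx x : hdot x x = (rnorm x ^+ 2)%:C.
Proof. by rewrite hdotE -rnormE -rmorphXn. Qed.

Lemma rnorm_hdot x y : rnorm (hdot x y) <= rnorm x * rnorm y.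
Proof.
rewrite -(@ler_pXn2r _ 2)// ?nnegrE ?mulr_ge0 ?rnorm_ge0//.
rewrite -lecR exprMn rmorphXn/= rnormE rmorphM/= -!hdotxx.
exact: dot_CauchySchwarz.
Qed.

Lemma hdot_inj x y : (forall z, hdot x z = hdot y z) -> x = y.
Proof.
move=> h; apply/eqP; rewrite -subr_eq0; apply/eqP/rnorm_eq0/eqP.
by rewrite -sqrf_eq0; apply/eqP/complexI; rewrite -hdotxx hdotBl h subrr.
Qed.

Lemma hadjointC (S T : H -> H) : hadjoint S T -> hadjoint T S.
Proof. by move=> h x y; rewrite hdotC -h -hdotC. Qed.

Lemma hadjoint_uniq (S T1 T2 : H -> H) :
  hadjoint S T1 -> hadjoint S T2 -> T1 = T2.
Proof.
move=> h1 h2; apply/funext => x; apply: hdot_inj => z.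
by rewrite (hadjointC h1) (hadjointC h2).
Qed.

Lemma hadjointD (S1 S2 T1 T2 : H -> H) :
  hadjoint S1 T1 -> hadjoint S2 T2 -> hadjoint (S1 + S2) (T1 + T2).
Proof. by move=> h1 h2 x y; rewrite !fctE hdotDl hdotDr h1 h2. Qed.

Lemma hadjointB (S1 S2 T1 T2 : H -> H) :
  hadjoint S1 T1 -> hadjoint S2 T2 -> hadjoint (S1 - S2) (T1 - T2).
Proof. by move=> h1 h2 x y; rewrite !fctE hdotBl hdotBr h1 h2. Qed.

Lemma hadjoint0 : hadjoint (0 : H -> H) 0.
Proof. by move=> x y; exact: (etrans (hdot0l y) (esym (hdot0r x))). Qed.

Lemma hadjointZ (c : R[i]) (S T : H -> H) :
  hadjoint S T -> hadjoint (c *: S) (Num.conj c *: T).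
Proof. by move=> h x y; rewrite !fctE hdotZl hdotZr conjCK h. Qed.

Lemma hadjoint_comp (S1 S2 T1 T2 : H -> H) :
  hadjoint S1 T1 -> hadjoint S2 T2 -> hadjoint (S1 \o S2) (T2 \o T1).
Proof. by move=> h1 h2 x y; rewrite /= h1 h2. Qed.

Definition opbound (c : R) (T : H -> H) : Prop :=
  forall x, rnorm (T x) <= c * rnorm x.

Lemma opboundW (c d : R) (T : H -> H) : c <= d -> opbound c T -> opbound d T.
Proof. by move=> cd h x; rewrite (le_trans (h x))// ler_wpM2r ?rnorm_ge0. Qed.

Lemma opboundD (c d : R) (S T : H -> H) :
  opbound c S -> opbound d T -> opbound (c + d) (S + T).
Proof.
move=> hS hT x; rewrite fctE mulrDl (le_trans (ler_rnormD _ _))//.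
exact: lerD.
Qed.

Lemma opboundZ (c : R) (a : R[i]) (T : H -> H) :
  opbound c T -> opbound (rnorm a * c) (a *: T).
Proof.
by move=> h x; rewrite fctE rnormZ -mulrA ler_wpM2l ?rnorm_ge0.
Qed.

Lemma opbound_comp (c d : R) (S T : H -> H) : 0 <= c ->
  opbound c S -> opbound d T -> opbound (c * d) (S \o T).
Proof.
move=> c0 hS hT x; rewrite (le_trans (hS _))// -mulrA ler_wpM2l//.
Qed.

(** The square of [rnorm (T x)] is [hdot (S (T x)) x], to which Cauchy-Schwarz applies; one factor
    [rnorm (T x)] is then cancelled. *)
Lemma opbound_adj (c : R) (S T : H -> H) : 0 <= c ->
  hadjoint S T -> opbound c S -> opbound c T.
Proof.
move=> c0 ST hS x; have [->|] := eqVneq (rnorm (T x)) 0.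
  by rewrite mulr_ge0 ?rnorm_ge0.
move=> Tx0; have Tx : 0 < rnorm (T x) by rewrite lt_neqAle eq_sym Tx0 rnorm_ge0.
rewrite -(ler_pM2l Tx) -expr2 -[leLHS]ger0_norm ?sqr_ge0// -rnorm_real.
rewrite -hdotxx -ST (le_trans (rnorm_hdot _ _))//.
by rewrite mulrA ler_wpM2r ?rnorm_ge0// mulrC.
Qed.

Lemma bounded_opbound (T : H -> H) :
  bounded_op H T -> exists2 c : R, 0 < c & opbound c T.
Proof.
move=> [_ [c hc]]; exists (`|c| + 1); first by rewrite ltr_wpDl.
by apply: opboundW hc; rewrite (le_trans (ler_norm c))// lerDl ler01.
Qed.

Section Linear.
Variable T : H -> H.
Hypothesis linT : linear T.

Lemma linop0 : T 0 = 0.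
Proof. by have := linT (-1) 0 0; rewrite scaler0 addr0 scaleN1r addNr. Qed.

Lemma linopD x y : T (x + y) = T x + T y.
Proof. by have := linT 1 x y; rewrite !scale1r. Qed.

Lemma linopZ a x : T (a *: x) = a *: T x.
Proof. by have := linT a x 0; rewrite !addr0 linop0 addr0. Qed.

Lemma linopB x y : T (x - y) = T x - T y.
Proof. by rewrite linopD -scaleN1r linopZ scaleN1r. Qed.

Lemma linop_sum (I : finType) (f : I -> H) : T (\sum_i f i) = \sum_i T (f i).
Proof.
apply: (big_ind2 (fun u v => T u = v)) => [|x _ y _ <- <-|//].
  exact: linop0.
exact: linopD.
Qed.

End Linear.

Lemma opnorm_has_sup (c : R) (T : H -> H) : 0 <= c -> opbound c T ->
  has_ubound [set rnorm (T x) | x in [set x : H | rnorm x <= 1]].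
Proof.
move=> c0 hT; exists c => _ [x /= x1 <-]; rewrite (le_trans (hT x))//.
by rewrite ler_piMr.
Qed.

Lemma opnorm_le (c : R) (T : H -> H) : 0 <= c -> opbound c T -> opnorm T <= c.
Proof.
move=> c0 hT; apply: ge_sup.
  by exists (rnorm (T 0)); exists 0 => //=; rewrite rnorm0 ler01.
move=> _ [x /= x1 <-]; rewrite (le_trans (hT x))//.
by rewrite ler_piMr.
Qed.

Lemma opnorm_ge0 (T : H -> H) : bounded_op H T -> 0 <= opnorm T.
Proof.
move=> bT; have [c c0 hT] := bounded_opbound bT.
apply: (le_trans (rnorm_ge0 (T 0))).
apply: (ub_le_sup (opnorm_has_sup (ltW c0) hT)).
by exists 0 => //=; rewrite rnorm0 ler01.
Qed.

Lemma opbound_opnorm (T : H -> H) : bounded_op H T -> opbound (opnorm T) T.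
Proof.
move=> bT x; have [c c0 hT] := bounded_opbound bT.
have [x0|x0] := eqVneq (rnorm x) 0.
  by rewrite (rnorm_eq0 x0) (linop0 bT.1) rnorm0 mulr0.
have nx : 0 < rnorm x by rewrite lt_neqAle eq_sym x0 rnorm_ge0.
rewrite -ler_pdivrMr//; apply: (ub_le_sup (opnorm_has_sup (ltW c0) hT)).
have nC : rnorm ((rnorm x)^-1%:C : R[i]) = (rnorm x)^-1.
  by rewrite rnorm_real gtr0_norm// invr_gt0.
exists ((rnorm x)^-1%:C *: x) => /=; first by rewrite rnormZ nC mulVf.
by rewrite (linopZ bT.1) rnormZ nC mulrC.
Qed.

Lemma opnorm0 : opnorm (0 : H -> H) = 0.
Proof.
have b0 : opbound 0 (0 : H -> H) by move=> x; rewrite mul0r [rnorm _]rnorm0.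
apply/eqP; rewrite eq_le opnorm_le// opnorm_ge0//; split.
  by move=> a x y; exact: esym (etrans (addr0 _) (scaler0 _ _)).
by exists 0.
Qed.

End HilbertSpace.

Lemma geometric_small (R : realType) (e : R) : 0 < e ->
  exists n, 2 * 2^-1 ^+ n < e.
Proof.
move=> e0; have e2 : 0 < e / 2 by rewrite divr_gt0.
have /cvgrPdist_lt/(_ _ e2)[n _ hn] : (2^-1 : R) ^+ n @[n --> \oo] --> 0.
  by apply: cvg_expr; rewrite ger0_norm ?invr_ge0// invf_lt1// ltr1n.
exists n; have := hn n (leqnn n) => /=.
by rewrite sub0r normrN ger0_norm ?exprn_ge0 ?invr_ge0// ltr_pdivlMr// mulrC.
Qed.

(** * Norm limits inside an operator algebra *)

Section OperatorAlgebra.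
Variables (R : realType) (H : hilbertType R) (A : set (H -> H)).
Hypothesis hA : operator_algebra A.

Lemma opalg_linear T : A T -> linear T.
Proof. by move=> /(opalg_bounded hA)[]. Qed.

Lemma opalg_opbound T : A T -> exists2 c : R, 0 < c & opbound c T.
Proof. by move=> /(opalg_bounded hA); exact: bounded_opbound. Qed.

Lemma opalgB S T : A S -> A T -> A (S - T).
Proof.
by move=> AS AT; rewrite -scaleN1r; apply: opalgD => //; apply: opalgZ.
Qed.

Lemma opalg_sum (I : finType) (b : I -> H -> H) (c : I -> R[i]) :
  (forall i, A (b i)) -> A (\sum_i c i *: b i).
Proof.
move=> Ab; elim/big_ind : _ => [|S T|i _]; first exact: opalg0.
  exact: opalgD.
exact: opalgZ.
Qed.

(** An approximant at distance 1 makes [T] bounded, and approximating within [e / 2] gives the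
    strict inequality that [opalg_closed] asks for. *)
Lemma opalg_limit T : linear T ->
  (forall e : R, 0 < e -> exists2 S, A S & opbound e (T - S)) -> A T.
Proof.
move=> linT h; apply: (opalg_closed hA).
  split=> //; have [S AS TS] := h 1 ltr01.
  have [c _ hS] := opalg_opbound AS; exists (1 + c) => x.
  by rewrite -[T x](subrK (S x)); exact: (opboundD TS hS).
move=> e e0; have e20 : 0 < e / 2 by rewrite divr_gt0.
have [S AS TS] := h _ e20; exists S => //.
rewrite (le_lt_trans (opnorm_le (ltW e20) TS))//.
by rewrite ltr_pdivrMr// ltr_pMr// ltr1n.
Qed.

Lemma opalg_geometric (S : nat -> H -> H) :
  (forall n, A (S n)) -> (forall n, opbound (2^-1 ^+ n) (S n.+1 - S n)) ->
  exists2 L, A L & forall n, opbound (2 * 2^-1 ^+ n) (L - S n).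
Proof.
move=> AS hS.
have dist x n m : (n <= m)%N ->
    rnorm (S m x - S n x) <= 2 * 2^-1 ^+ n * rnorm x.
  move=> /subnKC <-; move: (m - n)%N => {m} k.
  (* Subtracting the tail [2 * 2^-1 ^+ (n + k)] strengthens the bound just enough for the induction
     on [k] to close. *)
  suff h : rnorm (S (n + k)%N x - S n x) <=
      (2 * 2^-1 ^+ n - 2 * 2^-1 ^+ (n + k)) * rnorm x.
    apply: (le_trans h); rewrite ler_wpM2r ?rnorm_ge0// lerBlDr lerDl.
    by rewrite mulr_ge0// exprn_ge0// invr_ge0.
  elim: k => [|k IH]; first by rewrite addn0 !subrr mul0r rnorm0.
  apply: (le_trans (ler_rdistD (S (n + k)%N x) _ _)).
  rewrite addnS; have := hS (n + k)%N x; rewrite !fctE => h.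
  apply: (le_trans (lerD h IH)); rewrite -mulrDl ler_wpM2r ?rnorm_ge0//.
  by rewrite exprS; lra.
have ex x : exists l, forall n, rnorm (l - S n x) <= 2 * 2^-1 ^+ n * rnorm x.
  apply: complete_seq (dist x) _ => e e0.
  have c0 : 0 < rnorm x + 1 by rewrite ltr_wpDl// rnorm_ge0.
  have [n hn] := geometric_small (divr_gt0 e0 c0); exists n.
  move: hn; rewrite ltr_pdivlMr//; apply: le_lt_trans.
  by rewrite ler_wpM2l ?lerDl// mulr_ge0// exprn_ge0// invr_ge0.
have [L hL] := choice ex.
exists L => [|n x]; last by rewrite !fctE; exact: hL.
apply: opalg_limit => [a x y|e e0]; last first.
  have [n hn] := geometric_small e0; exists (S n) => //.
  by apply: opboundW (ltW hn) _ => x; rewrite !fctE; exact: hL.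
apply/eqP; rewrite -subr_eq0; apply/eqP.
apply: (@rnorm_small _ _
  (rnorm (a *: x + y) + (rnorm a * rnorm x + rnorm y))) => e e0.
have [n hn] := geometric_small e0.
apply: (@le_trans _ _ (2 * 2^-1 ^+ n *
  (rnorm (a *: x + y) + (rnorm a * rnorm x + rnorm y)))); last first.
  by rewrite ler_wpM2r ?(ltW hn)// !addr_ge0 ?mulr_ge0 ?rnorm_ge0.
apply: (le_trans (ler_rdistD (S n (a *: x + y)) _ _)).
rewrite mulrDr lerD//.
rewrite (opalg_linear (AS n)) opprD addrACA -scalerBr.
rewrite (le_trans (ler_rnormD _ _))// rnormZ mulrDr lerD//.
  by rewrite mulrCA ler_wpM2l ?rnorm_ge0// rdistC hL.
by rewrite rdistC hL.
Qed.

End OperatorAlgebra.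

(** * Boundedness of star-homomorphisms and induction on a generated C*-algebra *)

Section StarHom.
Variables (R : realType) (K : hilbertType R) (C : set (K -> K)).
Hypothesis hC : cstar_algebra C.

Let hCA := cstar_opalg hC.

(* [1 - S] is the square root of [1 - T' T], obtained as the fixed point of
   [S |-> (T' T + S S) / 2], which is a contraction of the ball of
   radius 1/2. *)
Lemma cstar_sqrt T T' : C T -> C T' -> hadjoint T T' -> opbound 2^-1 T ->
  exists S, [/\ C S, hadjoint S S & S + S = (T' \o T) + (S \o S)].
Proof.
move=> CT CT' TT' hT.
have h0 : 0 <= 2^-1 :> R by rewrite invr_ge0.
have hT' := opbound_adj h0 TT' hT.
pose f (S : K -> K) := (2^-1 : R[i]) *: ((T' \o T) + (S \o S)).
have n2 : rnorm (2^-1 : R[i]) = 2^-1.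
  by rewrite -(rmorph_nat (real_complex R)) -fmorphV rnorm_real ger0_norm.
have half (V : lmodType R[i]) (v : V) : 2^-1 *: v + 2^-1 *: v = v.
  by rewrite -scalerDl -[2^-1]mul1r -splitr scale1r.
pose S n := iter n f 0.
have CS n : C (S n).
  elim: n => [|n IH]; first exact: (opalg0 hCA).
  by apply: (opalgZ hCA); apply: (opalgD hCA); apply: (opalgM hCA).
have bS n : opbound 2^-1 (S n).
  elim: n => [x|n IH]; first by rewrite /= rnorm0 mulr_ge0// rnorm_ge0.
  have := opboundZ 2^-1
    (opboundD (opbound_comp h0 hT' hT) (opbound_comp h0 IH IH)).
  by rewrite n2; apply: opboundW; lra.
have aS n : hadjoint (S n) (S n).
  elim: n => [|n IH]; first exact: hadjoint0.
  have := hadjointZ 2^-1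
    (hadjointD (hadjoint_comp (hadjointC TT') TT') (hadjoint_comp IH IH)).
  by rewrite -[Num.conj _]/(Num.conj _) fmorphV rmorph_nat.
have dS n : opbound (2^-1 ^+ n) (S n.+1 - S n).
  elim: n => [|n IH].
    rewrite expr0 subr0; apply: opboundW (bS 1%N).
    by rewrite invf_le1// ler1n.
  move=> x; rewrite !fctE/= -scalerBr rnormZ n2 exprS -mulrA ler_wpM2l//.
  rewrite opprD addrACA subrr add0r.
  (* The difference of squares splits into [S n.+1 (S n.+1 x - S n x)] and [(S n.+1 - S n) (S n x)].
     The bound [2^-1] on the iterates halves each of them, and the outer factor [2^-1] yields the
     next power. *)
  rewrite -(subrKA (S n.+1 (S n x))) -(linopB (opalg_linear hCA (CS n.+1))).
  rewrite (le_trans (ler_rnormD _ _))//.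
  have h1 := IH x; have h2 := IH (S n x); have h3 := bS n x.
  have h4 := bS n.+1 (S n.+1 x - S n x).
  rewrite !fctE/= in h1 h2 h3 h4.
  have p0 : 0 <= 2^-1 ^+ n :> R by rewrite exprn_ge0.
  have h5 := ler_wpM2l p0 h3; rewrite mulrA in h5.
  by lra.
have [L CL hL] := opalg_geometric hCA CS dS.
have small (V : normedZmodType R[i]) (x : V) (c : R) :
    (forall n, rnorm x <= 2 * 2^-1 ^+ n * c) -> x = 0.
  move=> h; have c0 : 0 <= c.
    by have := le_trans (rnorm_ge0 x) (h 0%N); rewrite expr0; lra.
  apply: (@rnorm_small _ _ c) => e /geometric_small[n /ltW hn].
  by rewrite (le_trans (h n))// ler_wpM2r.
have bL : opbound (2^-1 + 2) L.
  have := opboundD (bS 0%N) (hL 0%N).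
  by rewrite expr0 mulr1 /= add0r subr0.
exists L; split => // [x y|].
  apply/eqP; rewrite -subr_eq0; apply/eqP.
  apply: (small _ _ (rnorm x * rnorm y + rnorm x * rnorm y)) => n.
  rewrite -(subrKA (hdot (S n x) y)) {2}aS -hdotBl -hdotBr mulrDr.
  rewrite (le_trans (ler_rnormD _ _))//.
  apply: lerD; rewrite (le_trans (rnorm_hdot _ _))//.
    by rewrite mulrA ler_wpM2r ?rnorm_ge0//; exact: hL.
  by rewrite mulrCA ler_wpM2l ?rnorm_ge0// rdistC; exact: hL.
apply/funext => x; apply/eqP; rewrite -subr_eq0; apply/eqP.
(* In units of [2^-1 ^+ n * rnorm x], the two copies of [L x - S n.+1 x] cost 2, the term
   [S n (S n x - L x)] costs 1 and [(S n - L) (L x)] costs 5; the total 8 is [2 * 4]. *)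
apply: (small _ _ (4 * rnorm x)) => n.
have E : S n.+1 x + S n.+1 x = T' (T x) + S n (S n x).
  by rewrite -[RHS](half _).
rewrite -[(L + L) x]/(L x + L x) -[(_ + (L \o L)) x]/(T' (T x) + L (L x)).
have -> : L x + L x - (T' (T x) + L (L x)) =
    (L x - S n.+1 x) + (L x - S n.+1 x) +
    ((S n (S n x) - S n (L x)) + (S n (L x) - L (L x))).
  by rewrite subrKA [L x - _ + _]addrACA -opprD E !opprD -!addrA addKr.
rewrite -(linopB (opalg_linear hCA (CS n))).
have h1 : rnorm (L x - S n.+1 x) <= 2 * 2^-1 ^+ n.+1 * rnorm x := hL n.+1 x.
have h2 := hL n x; have h3 := hL n (L x).
have h4 := bS n (S n x - L x); have h5 := bL x.
rewrite !fctE/= in h2 h3 h4.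
have p0 : 0 <= 2^-1 ^+ n :> R by rewrite exprn_ge0.
have h6 := ler_wpM2l p0 h5.
rewrite (rdistC (S n x)) in h4.
have h7 := ler_rnormD (L x - S n.+1 x + (L x - S n.+1 x))
  (S n (S n x - L x) + (S n (L x) - L (L x))).
have h8 := ler_rnormD (L x - S n.+1 x) (L x - S n.+1 x).
have h9 := ler_rnormD (S n (S n x - L x)) (S n (L x) - L (L x)).
rewrite (rdistC (S n (L x))) in h9.
by rewrite exprS in h1; lra.
Qed.

(** Dividing by [2 * c] brings the norm down to [2^-1], where [cstar_sqrt] applies; hence the factor
    2. The relation [S + S = W' W + S S] says [(1 - S)^2 = 1 - W' W] without naming a unit, so [pi]
    preserves it. The squared norm of [x] minus that of [pi W x] is then the squared norm of
    [x - pi S x]. *)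
Lemma star_hom_opbound (L : hilbertType R) (pi : (K -> K) -> (L -> L)) T c :
  star_hom C (bounded_op L) pi -> C T -> 0 < c -> opbound c T ->
  opbound (2 * c) (pi T).
Proof.
move=> hpi CT c0 hT; have hA := star_hom_alg hpi.
have c20 : 0 < 2 * c by rewrite mulr_gt0.
pose W := ((2 * c)^-1)%:C *: T.
have CW : C W by exact: opalgZ.
have hW : opbound 2^-1 W.
  have -> : 2^-1 = rnorm (((2 * c)^-1)%:C : R[i]) * c.
    rewrite rnorm_real gtr0_norm ?invr_gt0//.
    by rewrite invfM -mulrA mulVf ?gt_eqF// mulr1.
  exact: opboundZ.
have [W' CW' WW'] := cstar_adj hC CW.
have [S [CS SS E]] := cstar_sqrt CW CW' WW' hW.
have hWW' := star_hom_adj hpi CW CW' WW'.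
have hSS := star_hom_adj hpi CS CS SS.
have piW : opbound 1 (pi W).
  move=> x; rewrite mul1r -(@ler_pXn2r _ 2)// ?nnegrE ?rnorm_ge0//.
  rewrite -subr_ge0 [leRHS](_ : _ = rnorm (x - pi S x) ^+ 2) ?sqr_ge0//.
  apply: complexI; rewrite rmorphB/= -!hdotxx !(hdotBl, hdotBr) !hSS hWW'.
  have : pi S x + pi S x = pi W' (pi W x) + pi S (pi S x).
    have CWW := opalgM hCA CW' CW; have CSS := opalgM hCA CS CS.
    rewrite -[LHS]/((pi S + pi S) x) -(alg_homD hA CS CS) E.
    by rewrite (alg_homD hA CWW CSS) (alg_homM hA CW' CW) (alg_homM hA CS CS).
  move/(congr1 (hdot x)); rewrite !hdotDr => E'.
  have -> : hdot x (pi W' (pi W x)) =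
      hdot x (pi S x) + hdot x (pi S x) - hdot x (pi S (pi S x)).
    by rewrite E' addrK.
  by ring.
have -> : T = (2 * c)%:C *: W.
  by rewrite /W scalerA -rmorphM/= mulfV ?gt_eqF// scale1r.
rewrite (alg_homZ hA)//; have := opboundZ (2 * c)%:C piW.
by rewrite mulr1 rnorm_real gtr0_norm.
Qed.

(* [P] is not assumed to be stable under adjoints: the elements of [C] all of
   whose adjoints satisfy [P] already form a C*-algebra. *)
Lemma cstar_generated_ind (G : set (K -> K)) (P : (K -> K) -> Prop) :
  smallest (@cstar_algebra R K) G = C ->
  P 0 -> (forall T, G T -> P T) ->
  (forall S T, G S -> C T -> hadjoint S T -> P T) ->
  (forall S T, C S -> C T -> P S -> P T -> P (S + T)) ->
  (forall (c : R[i]) T, C T -> P T -> P (c *: T)) ->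
  (forall S T, C S -> C T -> P S -> P T -> P (S \o T)) ->
  (forall T, C T -> (forall e : R, 0 < e ->
     exists S, [/\ C S, P S & opbound e (T - S)]) -> P T) ->
  forall T, C T -> P T.
Proof.
move=> hG P0 PG PG' PD PZ PM Plim T CT.
pose X : set (K -> K) := [set S | [/\ C S, P S &
  forall S', C S' -> hadjoint S S' -> P S']].
suff XC : cstar_algebra X.
  suff : X T by case.
  have GC : G `<=` C by rewrite -hG; exact: sub_smallest.
  have : smallest (@cstar_algebra R K) G T by rewrite hG.
  by apply; split=> // S GS; split; [exact: GC|exact: PG|
    move=> S'; exact: PG'].
split; last first.
  move=> S [CS PS PS']; have [S' CS' SS'] := cstar_adj hC CS.
  exists S' => //; split; [by []|exact: PS'|move=> S'' CS'' SS''].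
  by rewrite (hadjoint_uniq SS'' (hadjointC SS')).
split.
- by move=> S [/(opalg_bounded hCA)].
- split; [exact: (opalg0 hCA)|exact: P0|move=> S' CS' SS'].
  by rewrite (hadjoint_uniq SS' (@hadjoint0 _ _)).
- move=> S1 S2 [CS1 P1 P1'] [CS2 P2 P2'].
  split; [exact: opalgD|exact: PD|move=> S' CS' SS'].
  have [S1' CS1' SS1'] := cstar_adj hC CS1.
  have [S2' CS2' SS2'] := cstar_adj hC CS2.
  rewrite (hadjoint_uniq SS' (hadjointD SS1' SS2')).
  by apply: PD => //; [exact: P1'|exact: P2'].
- move=> c S1 [CS1 P1 P1'].
  split; [exact: opalgZ|exact: PZ|move=> S' CS' SS'].
  have [S1' CS1' SS1'] := cstar_adj hC CS1.
  rewrite (hadjoint_uniq SS' (hadjointZ c SS1')).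
  by apply: PZ => //; exact: P1'.
- move=> S1 S2 [CS1 P1 P1'] [CS2 P2 P2'].
  split; [exact: opalgM|exact: PM|move=> S' CS' SS'].
  have [S1' CS1' SS1'] := cstar_adj hC CS1.
  have [S2' CS2' SS2'] := cstar_adj hC CS2.
  rewrite (hadjoint_uniq SS' (hadjoint_comp SS1' SS2')).
  by apply: PM => //; [exact: P2'|exact: P1'].
- move=> S bS hS.
  have CS : C S.
    by apply: (opalg_closed hCA) => // e /hS[S1 [CS1 _ _] ?]; exists S1.
  have approx e : 0 < e -> exists S1, [/\ C S1, X S1 & opbound e (S - S1)].
    move=> /hS[S1 XS1 SS1]; have CS1 : C S1 by case: XS1.
    exists S1; split => //; apply: opboundW (ltW SS1) _.
    by apply: opbound_opnorm; apply: (opalg_bounded hCA); exact: opalgB.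
  split=> // [|S' CS' SS'].
    by apply: Plim => // e /approx[S1 [CS1 [_ PS1 _] ?]]; exists S1.
  apply: Plim => // e e0; have [S1 [CS1 [_ _ PS1'] SS1]] := approx _ e0.
  have [S1' CS1' aS1'] := cstar_adj hC CS1.
  exists S1'; split => //; first exact: PS1'.
  exact: opbound_adj (ltW e0) (hadjointB SS' aS1') SS1.
Qed.

End StarHom.

(** * Orthogonal projections, compressions and Gram-Schmidt *)

Section Projections.
Variables (R : realType) (K : hilbertType R).

(** Range and kernel are orthogonal: if [q u = u] and [q v = 0], let [w = u - a *: v] be the part of
    [u] orthogonal to [v]. Then [q w = u], so [u] is no longer than [w], and Pythagoras forces
    [a = 0]. Hence [hdot (q x) y], [hdot (q x) (q y)] and [hdot x (q y)] agree. *)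
Lemma contractive_idempotent_hadjoint (q : K -> K) :
  linear q -> opbound 1 q -> q \o q = q -> hadjoint q q.
Proof.
move=> linq hq qq.
have {}qq x : q (q x) = q x by rewrite -[LHS]/((q \o q) x) qq.
have orth u v : q u = u -> q v = 0 -> hdot u v = 0.
  move=> qu qv; have [->|v0] := eqVneq v 0; first by rewrite hdot0r.
  have vv : 0 < hdot v v by rewrite dnorm_gt0.
  pose a := hdot u v / hdot v v; pose w := u - a *: v.
  have wv : hdot w v = 0.
    by rewrite hdotBl hdotZl divfK ?subrr// gt_eqF.
  have uE : hdot u u = hdot w w + `|a| ^+ 2 * hdot v v.
    rewrite -dnormZ -[in LHS](subrK (a *: v) u) -/w hnormDd//=.
    by rewrite hdotZr wv mulr0.
  have : hdot u u <= hdot w w.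
    have := hq w; rewrite linopB// linopZ// qu qv scaler0 subr0 mul1r => uw.
    by rewrite !hdotxx lecR lerXn2r ?nnegrE ?rnorm_ge0.
  rewrite uE gerDl pmulr_lle0// => a0.
  have /eqP : `|a| ^+ 2 = 0 by apply/eqP; rewrite eq_le a0 exprn_ge0.
  rewrite expf_eq0/= normr_eq0 mulf_eq0 invr_eq0 (gt_eqF vv) orbF.
  by move/eqP.
move=> x y; have h1 : hdot (q x) (y - q y) = 0.
  by apply: orth => //; rewrite linopB// qq subrr.
have h2 : hdot (q y) (x - q x) = 0.
  by apply: orth => //; rewrite linopB// qq subrr.
move/eqP : h1; rewrite hdotBr subr_eq0 => /eqP ->.
move/eqP : h2; rewrite hdotBr subr_eq0 => /eqP h2.
by rewrite [RHS]hdotC h2 -hdotC.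
Qed.

Lemma projection_opbound (q : K -> K) :
  hadjoint q q -> (forall x, q (q x) = q x) -> opbound 1 q.
Proof.
move=> aq qq x; rewrite mul1r.
have [->|] := eqVneq (rnorm (q x)) 0; first exact: rnorm_ge0.
move=> qx0; have qx : 0 < rnorm (q x) by rewrite lt_neqAle eq_sym qx0 rnorm_ge0.
rewrite -(ler_pM2r qx) -expr2 -[leLHS]ger0_norm ?sqr_ge0// -rnorm_real.
by rewrite -hdotxx aq qq rnorm_hdot.
Qed.

Definition orthonormal_family r (e : 'I_r -> K) : Prop :=
  forall i j, hdot (e i) (e j) = (i == j)%:R.

Definition span_proj r (e : 'I_r -> K) (x : K) : K := \sum_i hdot x (e i) *: e i.

Lemma proj_linear r (e : 'I_r -> K) : linear (span_proj e).
Proof.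
move=> a x y; rewrite /span_proj scaler_sumr -big_split/=; apply: eq_bigr => i _.
by rewrite hdotDl hdotZl scalerDl scalerA.
Qed.

Lemma proj_hadjoint r (e : 'I_r -> K) : hadjoint (span_proj e) (span_proj e).
Proof.
move=> x y; rewrite /span_proj hdot_suml hdot_sumr; apply: eq_bigr => i _.
by rewrite hdotZl hdotZr -hdotC mulrC.
Qed.

Section Orthonormal.
Variables (r : nat) (e : 'I_r -> K).
Hypothesis he : orthonormal_family e.

Lemma hdot_orthonormal (c : 'I_r -> R[i]) i :
  hdot (\sum_j c j *: e j) (e i) = c i.
Proof.
rewrite hdot_suml (bigD1 i)//= hdotZl he eqxx mulr1 big1 ?addr0// => j ji.
by rewrite hdotZl he (negbTE ji) mulr0.
Qed.

Lemma proj_sum (c : 'I_r -> R[i]) :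
  span_proj e (\sum_j c j *: e j) = \sum_j c j *: e j.
Proof. by apply: eq_bigr => i _; rewrite hdot_orthonormal. Qed.

Lemma proj_idem x : span_proj e (span_proj e x) = span_proj e x.
Proof. exact: proj_sum. Qed.

Lemma proj_opbound : opbound 1 (span_proj e).
Proof. exact: projection_opbound (proj_hadjoint e) proj_idem. Qed.

Lemma proj_basis i : span_proj e (e i) = e i.
Proof.
rewrite /span_proj (bigD1 i)//= he eqxx scale1r big1 ?addr0// => j ji.
by rewrite he eq_sym (negbTE ji) scale0r.
Qed.

Lemma rnorm_orthonormal (c : 'I_r -> R[i]) :
  rnorm (\sum_j c j *: e j) ^+ 2 = \sum_j rnorm (c j) ^+ 2.
Proof.
apply: complexI; rewrite -hdotxx hdot_sumr rmorph_sum/=; apply: eq_bigr => i _.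
by rewrite hdotZr hdot_orthonormal mulrC -normCK -rnormE rmorphXn.
Qed.

Definition compress (T : K -> K) : 'M[R[i]]_r :=
  \matrix_(i, j) hdot (T (e j)) (e i).

Lemma compressD S T : compress (S + T) = compress S + compress T.
Proof. by apply/matrixP => i j; rewrite !mxE -hdotDl. Qed.

Lemma compressZ (c : R[i]) T : compress (c *: T) = c *: compress T.
Proof. by apply/matrixP => i j; rewrite !mxE -hdotZl. Qed.

(** As [T (e j)] stays in the span, it can be expanded in [e] before [S] is applied, and the
    coefficients are the entries of [compress T]. *)
Lemma compressM S T : linear S -> (forall j, span_proj e (T (e j)) = T (e j)) ->
  compress (S \o T) = compress S *m compress T.
Proof.
move=> linS hT; apply/matrixP => i j; rewrite !mxE /= -hT /span_proj linop_sum//.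
rewrite hdot_suml; apply: eq_bigr => k _.
by rewrite linopZ// hdotZl !mxE mulrC.
Qed.

Lemma compress_adj S T : hadjoint S T ->
  compress T = map_mx (@Num.conj R[i]) (compress S)^T.
Proof. by move=> ST; apply/matrixP => i j; rewrite !mxE -hdotC (hadjointC ST). Qed.

Lemma compress_norm T (c : R) : linear T -> 0 <= c -> opbound c T ->
  matrix_cstar_norm (compress T) <= c.
Proof.
move=> linT c0 hT; apply: ge_sup.
  eexists; exists 0; last exact: erefl.
  by rewrite /= big1 ?ler01// => i _; rewrite mxE rnorm0 expr0n.
move=> _ [x /= x1 <-].
pose v := \sum_j x j 0 *: e j.
have E i : (compress T *m x) i 0 = hdot (T v) (e i).
  rewrite mxE /v linop_sum// hdot_suml; apply: eq_bigr => j _.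
  by rewrite mxE linopZ// hdotZl mulrC.
under eq_bigr do rewrite E.
rewrite -rnorm_orthonormal sqrtr_sqr ger0_norm ?rnorm_ge0//.
have v1 : rnorm v <= 1.
  by rewrite -(@ler_pXn2r _ 2)// ?nnegrE ?rnorm_ge0// rnorm_orthonormal expr1n.
have := proj_opbound (T v); rewrite mul1r => /le_trans; apply.
by rewrite (le_trans (hT v))// ler_piMr.
Qed.

End Orthonormal.

(** The last clause places every [e i] in the linear span of [s]. It quantifies over predicates [Q]
    closed under linear combinations, the form in which it later yields invariance under [mu]. *)
Lemma gram_schmidt (s : seq K) : exists r (e : 'I_r -> K),
  [/\ orthonormal_family e, forall x, x \in s -> span_proj e x = x &
    forall Q : K -> Prop, Q 0 ->
      (forall (a : R[i]) x y, Q x -> Q y -> Q (a *: x + y)) ->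
      (forall x, x \in s -> Q x) -> forall i, Q (e i)].
Proof.
elim: s => [|u s [r [e [he es eQ]]]].
  by exists 0%N, (fun=> 0); split=> [[]//| //|Q _ _ _ []//].
have sumQ (Q : K -> Prop) : Q 0 ->
      (forall (a : R[i]) x y, Q x -> Q y -> Q (a *: x + y)) ->
      (forall x, x \in s -> Q x) -> forall x, Q (span_proj e x).
  move=> Q0 QD Qs x; have Qe := eQ Q Q0 QD Qs; rewrite /span_proj.
  elim/big_rec : _ => // i y _ Qy.
  exact: QD.
have [pu|pu] := eqVneq (span_proj e u) u.
  exists r, e; split=> // [x|Q Q0 QD Qs].
    by rewrite inE => /predU1P[->//|/es].
  by apply: (eQ Q) => // x xs; apply: Qs; rewrite inE xs orbT.
pose w := u - span_proj e u.
have w0 : w != 0 by rewrite subr_eq0 eq_sym.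
have nw : rnorm w != 0 by apply: contra w0 => /eqP/rnorm_eq0 ->.
pose f := (rnorm w)^-1%:C *: w.
have we i : hdot w (e i) = 0.
  by rewrite hdotBl proj_hadjoint proj_basis// subrr.
have ff : hdot f f = 1.
  rewrite hdotxx rnormZ rnorm_real ger0_norm ?invr_ge0 ?rnorm_ge0//.
  by rewrite mulVf// expr1n.
have fe i : hdot f (e i) = 0 by rewrite hdotZl we mulr0.
have wf : w = (rnorm w)%:C *: f by rewrite scalerA -rmorphM mulfV// scale1r.
have pf : span_proj e f = 0 by rewrite /span_proj big1// => i _; rewrite fe scale0r.
pose e' (i : 'I_r.+1) := oapp e f (unlift ord0 i).
have e'0 : e' ord0 = f by rewrite /e' unlift_none.
have e'l i : e' (lift ord0 i) = e i by rewrite /e' liftK.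
have span_proj' x : span_proj e' x = hdot x f *: f + span_proj e x.
  rewrite /span_proj big_ord_recl e'0; congr (_ + _).
  by apply: eq_bigr => i _; rewrite e'l.
exists r.+1, e'; split.
- move=> i j; case: (unliftP ord0 i) => [i'|] ->; case: (unliftP ord0 j) => [j'|] ->;
    rewrite ?e'0 ?e'l.
  + by rewrite he (inj_eq lift_inj).
  + by rewrite hdotC fe rmorph0.
  + by rewrite fe.
  + by rewrite ff eqxx.
- move=> x; rewrite inE => /predU1P[->|xs]; rewrite span_proj'.
    rewrite -{1}(subrK (span_proj e u) u) -/w hdotDl proj_hadjoint pf hdot0r addr0.
    by rewrite {1}wf hdotZl ff mulr1 -wf subrK.
  by rewrite -{1}(es x xs) proj_hadjoint pf hdot0r scale0r add0r es.
- move=> Q Q0 QD Qs.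
  have Qs' x : x \in s -> Q x by move=> xs; apply: Qs; rewrite inE xs orbT.
  have Qe x : Q (span_proj e x) by exact: sumQ.
  have Qf : Q f.
    rewrite /f -[_ *: _]addr0; apply: (QD) => //.
    rewrite /w addrC -scaleN1r; apply: (QD) => //.
    by apply: Qs; rewrite inE eqxx.
  by move=> i; case: (unliftP ord0 i) => [i'|] ->; rewrite ?e'0 ?e'l//; exact: (eQ Q).
Qed.

End Projections.

(** * Homomorphisms between operator algebras *)

Section AlgebraMaps.
Variables (R : realType) (H K : hilbertType R).
Variables (A : set (H -> H)) (B : set (K -> K)) (phi : (H -> H) -> (K -> K)).
Hypotheses (hA : operator_algebra A) (hphi : alg_hom A B phi).

Lemma alg_hom0 : phi 0 = 0.
Proof.
by rewrite -(scale0r (0 : H -> H)) (alg_homZ hphi) ?scale0r//; exact: opalg0.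
Qed.

Lemma alg_homB S T : A S -> A T -> phi (S - T) = phi S - phi T.
Proof.
move=> AS AT; rewrite -[X in phi (S + X)](scaleN1r T) (alg_homD hphi AS).
  by rewrite (alg_homZ hphi _ AT) scaleN1r.
exact: opalgZ.
Qed.

Lemma alg_hom_sum (I : finType) (b : I -> H -> H) (c : I -> R[i]) :
  (forall i, A (b i)) -> phi (\sum_i c i *: b i) = \sum_i c i *: phi (b i).
Proof.
move=> Ab.
(* [phi] is known to be additive on [A] only, so membership of the partial sums is carried through
   the induction. *)
suff [] : A (\sum_i c i *: b i) /\
    phi (\sum_i c i *: b i) = \sum_i c i *: phi (b i) by [].
elim/big_ind2 : _ => [|S S' T T' [AS <-] [AT <-]|i _].
- by split; [exact: opalg0|exact: alg_hom0].
- by split; [exact: opalgD|exact: alg_homD hphi _ _ _ _].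
- by split; [exact: opalgZ|exact: alg_homZ hphi _ _ _].
Qed.

Lemma completely_isometric_opnorm T :
  completely_isometric A phi -> A T -> opnorm (phi T) = opnorm T.
Proof.
have E (L : hilbertType R) (U : L -> L) :
    mx_opnorm (\matrix_(i < 1, j < 1) U) = opnorm U.
  congr sup; apply/seteqP; split => _ [x /= x1 <-].
    exists (x 0).
      rewrite -(@ler_pXn2r _ 2)// ?nnegrE ?rnorm_ge0// expr1n.
      by move: x1; rewrite big_ord1.
    by rewrite !big_ord1 mxE sqrtr_sqr ger0_norm ?rnorm_ge0.
  exists (fun=> x); first by rewrite big_ord1 expr_le1// rnorm_ge0.
  by rewrite !big_ord1 mxE sqrtr_sqr ger0_norm ?rnorm_ge0.
move=> iso AT; have := iso 1%N (\matrix_(i, j) T).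
rewrite E => <-; last by move=> i j; rewrite mxE.
by rewrite -E; congr mx_opnorm; apply/matrixP => i j; rewrite !mxE.
Qed.

Lemma completely_isometric_inj S T : completely_isometric A phi ->
  A S -> A T -> phi S = phi T -> S = T.
Proof.
move=> iso AS AT ST; have AST := opalgB hA AS AT.
have := completely_isometric_opnorm iso AST.
rewrite alg_homB// ST subrr opnorm0 => n0; apply/eqP; rewrite -subr_eq0.
apply/eqP/funext => x; apply/rnorm_eq0/eqP; rewrite eq_le rnorm_ge0 andbT.
by have := opbound_opnorm (opalg_bounded hA AST) x; rewrite -n0 mul0r.
Qed.

End AlgebraMaps.

(** * Residual finite-dimensionality from separating representations *)

Section Separation.
Variables (R : realType) (K : hilbertType R) (C : set (K -> K)).
Hypothesis hC : cstar_algebra C.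

(** The index type [unit] makes a single matrix a family. The bound [2 * c] depends on [T] but not
    on the representation, so any family of such representations is bounded at [T]. *)
Definition matrix_rep r (M : (K -> K) -> 'M[R[i]]_r) : Prop :=
  matrix_star_hom C (fun T (_ : unit) => M T) /\
  forall T c, C T -> 0 < c -> opbound c T -> matrix_cstar_norm (M T) <= 2 * c.

(** All representations of positive size form one family, bounded thanks to the uniform estimate;
    one that does not kill [S - T] tells [S] from [T]. *)
Lemma separating_rfd :
  (forall T, C T -> T <> 0 ->
    exists r (M : (K -> K) -> 'M[R[i]]_r.+1), matrix_rep M /\ M T <> 0) ->
  residually_finite_dimensional C.
Proof.
move=> sep.
pose I := {p : {r & (K -> K) -> 'M[R[i]]_r.+1} | matrix_rep (projT2 p)}.
exists I, (fun l => (projT1 (sval l)).+1),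
  (fun T l => @projT2 nat (fun r => (K -> K) -> 'M[R[i]]_r.+1) (sval l) T).
split=> //.
  split=> [T CT|S T CS CT l|c T CT l|S T CS CT l|S T CS CT ST l].
  - have [c c0 hc] := opalg_opbound (cstar_opalg hC) CT.
    by exists (2 * c) => l; have [_] := svalP l; apply.
  - by have [/matrix_homD h _] := svalP l; exact: h tt.
  - by have [/matrix_homZ h _] := svalP l; exact: h tt.
  - by have [/matrix_homM h _] := svalP l; exact: h tt.
  - by have [/matrix_hom_adj h _] := svalP l; exact: h tt.
move=> S T CS CT ST; apply/eqP; rewrite -subr_eq0; apply/eqP.
apply: contrapT => ST0; have CST := opalgB (cstar_opalg hC) CS CT.
have [r [M [hM]]] := sep _ CST ST0; apply.
have [hM1 _] := hM.
have := congr1 (fun f => f (exist _ (existT _ r M) hM)) ST => /= E.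
rewrite -scaleN1r (matrix_homD hM1 CS _ tt) ?(matrix_homZ hM1 (-1) CT tt).
  by rewrite E scaleN1r subrr.
by apply: opalgZ => //; exact: cstar_opalg.
Qed.

End Separation.

(** Each component of a vector in the unit ball has norm at most 1, so the constants of the entries
    of a row add up to a bound for that row. This makes the [sup] in [mx_opnorm] a genuine upper
    bound. *)
Lemma mx_opnorm_has_ubound (R : realType) (H : hilbertType R) n
    (T : 'M[H -> H]_n) :
  (forall i j, exists2 c : R, 0 < c & opbound c (T i j)) ->
  has_ubound [set Num.sqrt (\sum_i rnorm (\sum_j T i j (x j)) ^+ 2)
      | x in [set x : 'I_n -> H | \sum_j rnorm (x j) ^+ 2 <= 1]].
Proof.
move=> hT.
have /choice[c hc] (p : 'I_n * 'I_n) :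
    exists c : R, 0 <= c /\ opbound c (T p.1 p.2).
  by have [c c0 ?] := hT p.1 p.2; exists c; rewrite ltW.
exists (Num.sqrt (\sum_i (\sum_j c (i, j)) ^+ 2)) => _ [x /= x1 <-].
apply: ler_wsqrtr; apply: ler_sum => i _.
have c0 j : 0 <= c (i, j) by have [] := hc (i, j).
rewrite lerXn2r ?nnegrE ?rnorm_ge0 ?sumr_ge0//.
rewrite (le_trans (ler_rnorm_sum _))//; apply: ler_sum => j _.
have [_ /= h] := hc (i, j); rewrite (le_trans (h _))// ler_piMr//.
rewrite -(@ler_pXn2r _ 2)// ?nnegrE ?rnorm_ge0// expr1n.
apply: le_trans x1; rewrite (bigD1 j)//= lerDl sumr_ge0// => k _.
exact: sqr_ge0.
Qed.

(** * Induction on the maximal C*-cover *)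

Section MaximalCover.
Variables (R : realType) (H K : hilbertType R).
Variables (A : set (H -> H)) (mu : (H -> H) -> (K -> K)) (C : set (K -> K)).
Hypotheses (hA : operator_algebra A) (hC : maximal_cstar_cover A mu C).

Let cC := cover_cstar hC.
Let oC := cstar_opalg cC.
Let hmu := cover_hom hC.

Lemma cover_mem T : A T -> C (mu T).
Proof. exact: (alg_hom_fun hmu). Qed.

Lemma cover_ind (P : (K -> K) -> Prop) :
  (forall S, A S -> P (mu S)) ->
  (forall S T, A S -> C T -> hadjoint (mu S) T -> P T) ->
  (forall S T, C S -> C T -> P S -> P T -> P (S + T)) ->
  (forall (c : R[i]) T, C T -> P T -> P (c *: T)) ->
  (forall S T, C S -> C T -> P S -> P T -> P (S \o T)) ->
  (forall T, C T -> (forall e : R, 0 < e ->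
     exists S, [/\ C S, P S & opbound e (T - S)]) -> P T) ->
  forall T, C T -> P T.
Proof.
move=> Pmu Padj PD PZ PM Pl.
apply: (@cstar_generated_ind _ _ _ cC _ P (cover_generated hC)) => //.
- by rewrite -(alg_hom0 hA hmu); apply: Pmu; exact: opalg0.
- by move=> _ [S AS <-]; exact: Pmu.
- by move=> _ T [S AS <-]; exact: Padj.
Qed.

(** * Restriction to a finite-dimensional subspace invariant under [mu] *)

Section Restriction.
Variables (r : nat) (e : 'I_r -> K).
Hypotheses (he : orthonormal_family e)
  (hinv : forall T, A T -> forall i, span_proj e (mu T (e i)) = mu T (e i)).

Lemma invariant_proj T x : A T ->
  span_proj e (mu T (span_proj e x)) = mu T (span_proj e x).
Proof.
move=> AT; have lT := opalg_linear oC (cover_mem AT).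
rewrite [in RHS]/span_proj [in LHS]/(span_proj e x) linop_sum// linop_sum; last first.
  exact: proj_linear.
by apply: eq_bigr => i _; rewrite !(linopZ lT) (linopZ (proj_linear e)) hinv.
Qed.

Lemma restriction_bounded T : A T -> bounded_op K (mu T \o span_proj e).
Proof.
move=> AT; have lT := opalg_linear oC (cover_mem AT).
split=> [a x y|]; first by rewrite /= proj_linear lT.
have [d d0 hd] := opalg_opbound oC (cover_mem AT).
by exists (d * 1); apply: opbound_comp (ltW d0) hd (proj_opbound he).
Qed.

(** The restriction to the span acts on all of [K], as zero on the orthogonal complement, so no new
    Hilbert space has to be built. With [P = span_proj e], invariance gives
    [mu S P mu T P = mu S mu T P], which is multiplicativity. *)
Lemma restriction_hom :
  alg_hom A (bounded_op K) (fun T => mu T \o span_proj e).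
Proof.
split=> [T AT|S T AS AT|c T AT|S T AS AT]; first exact: restriction_bounded.
- by rewrite (alg_homD hmu).
- by rewrite (alg_homZ hmu).
- by rewrite (alg_homM hmu)//; apply/funext => x /=; rewrite invariant_proj.
Qed.

Lemma restriction_completely_contractive :
  completely_contractive A (fun T => mu T \o span_proj e).
Proof.
move=> n T AT; rewrite -(cover_isometric hC AT).
have CT i j : C (map_mx mu T i j) by rewrite mxE; exact: cover_mem.
set M := map_mx mu T in CT *.
apply: ge_sup.
  eexists; exists 0; last exact: erefl.
  by rewrite /= big1 ?ler01// => i _; rewrite rnorm0 expr0n.
move=> _ [x /= x1 <-]; apply: ub_le_sup.
  apply: mx_opnorm_has_ubound => i j; exact: (opalg_opbound oC (CT i j)).
(* Projecting the components keeps the vector in the unit ball, so every value taken for [mu T P] is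
   also taken for [mu T]. *)
exists (fun j => span_proj e (x j)) => /=.
  apply: le_trans x1; apply: ler_sum => i _.
  rewrite ler_pXn2r ?nnegrE ?rnorm_ge0//.
  by have := proj_opbound he (x i); rewrite mul1r.
congr Num.sqrt; apply: eq_bigr => i _; congr (rnorm _ ^+ 2).
by apply: eq_bigr => j _; rewrite !mxE.
Qed.

Lemma restriction_extends : exists2 pi, star_hom C (bounded_op K) pi &
  forall T, A T -> pi (mu T) = mu T \o span_proj e.
Proof.
exact: (cover_universal hC) restriction_hom restriction_completely_contractive.
Qed.

Variable pi : (K -> K) -> (K -> K).
Hypotheses (hpi : star_hom C (bounded_op K) pi)
  (hpimu : forall T, A T -> pi (mu T) = mu T \o span_proj e).

Let api := star_hom_alg hpi.

Lemma star_hom_linear T : C T -> linear (pi T).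
Proof. by move=> CT; have [] := alg_hom_fun api CT. Qed.

Lemma restriction_adj S T : A S -> C T -> hadjoint (mu S) T ->
  pi T = span_proj e \o T.
Proof.
move=> AS CT ST; apply: hadjoint_uniq (star_hom_adj hpi (cover_mem AS) CT ST) _.
by rewrite hpimu//; exact: hadjoint_comp ST (proj_hadjoint e).
Qed.

(** On generators this is the invariance of the span; on their adjoints [pi T] is [T] followed by
    the projection; norm limits are controlled by [star_hom_opbound]. *)
Lemma star_hom_invariant T x : C T ->
  span_proj e (pi T (span_proj e x)) = pi T (span_proj e x).
Proof.
move=> CT; move: T CT x; apply: cover_ind.
- by move=> S AS x; rewrite hpimu//= proj_idem// invariant_proj.
- by move=> S T AS CT ST x; rewrite (restriction_adj AS CT ST)/= proj_idem.
- move=> S T CS CT hS hT x; rewrite (alg_homD api)// fctE.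
  by rewrite (linopD (proj_linear e)) hS hT.
- move=> c T CT hT x; rewrite (alg_homZ api)// fctE.
  by rewrite (linopZ (proj_linear e)) hT.
- move=> S T CS CT hS hT x; rewrite (alg_homM api)//=.
  by rewrite -hT hS.
- move=> T CT happ x; apply/eqP; rewrite -subr_eq0; apply/eqP.
  set y := span_proj e x.
  apply: (@rnorm_small _ _ (4 * rnorm y)) => d d0.
  have [S [CS hS TS]] := happ _ d0.
  have := star_hom_opbound cC hpi (opalgB oC CT CS) d0 TS.
  rewrite (alg_homB oC api)// => hTS.
  have h1 := hTS y; have h2 := proj_opbound he ((pi T - pi S) y).
  rewrite !fctE/= in h1 h2.
  rewrite (linopB (proj_linear e)) [span_proj e (pi S y)]hS in h2.
  have := ler_rdistD (pi S y) (span_proj e (pi T y)) (pi T y).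
  rewrite (rdistC (pi S y)).
  by lra.
Qed.

End Restriction.

(** * Central projections, strong convergence and separation of points *)

Section CentralApproximateUnit.
Variable E : nat -> H -> H.
Hypotheses (AE : forall n, A (E n))
  (E_idem : forall n, E n \o E n = E n)
  (E_norm : forall n, opnorm (E n) <= 1)
  (E_comm : forall n T, A T -> T \o E n = E n \o T)
  (E_approx : forall T, A T -> forall e : R, 0 < e ->
    exists N, forall n, (N <= n)%N -> opnorm (T - (T \o E n)) <= e)
  (E_fin : forall n, exists (I : finType) (b : I -> H -> H),
    (forall i, A (b i)) /\
    forall T, A T -> exists c : I -> R[i], T \o E n = \sum_i c i *: b i).

Let q n := mu (E n).

Let Cq n : C (q n). Proof. exact: cover_mem. Qed.

Lemma unit_linear n : linear (q n).
Proof. exact: (opalg_linear oC (Cq n)). Qed.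

Lemma unit_opbound n : opbound 1 (q n).
Proof.
apply: opboundW (opbound_opnorm (opalg_bounded oC (Cq n))).
by rewrite (completely_isometric_opnorm (cover_isometric hC)).
Qed.

Lemma unit_idem n : q n \o q n = q n.
Proof. by rewrite -(alg_homM hmu) ?E_idem. Qed.

Lemma unit_hadjoint n : hadjoint (q n) (q n).
Proof.
exact: contractive_idempotent_hadjoint (unit_linear n) (unit_opbound n)
  (unit_idem n).
Qed.

Lemma unit_comm_gen n T x : A T -> mu T (q n x) = q n (mu T x).
Proof.
move=> AT; rewrite -[LHS]/((mu T \o mu (E n)) x) -[RHS]/((mu (E n) \o mu T) x).
by rewrite -!(alg_homM hmu)// E_comm.
Qed.

(** The clause for adjoints follows from commutation with [mu S] by moving both operators across the
    inner product, as [q n] is self-adjoint. *)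
Lemma unit_comm n T x : C T -> T (q n x) = q n (T x).
Proof.
move=> CT; move: T CT x; apply: cover_ind.
- by move=> S AS x; exact: unit_comm_gen.
- move=> S T AS CT ST x; apply: hdot_inj => z.
  by rewrite (hadjointC ST) (unit_hadjoint n) -unit_comm_gen// unit_hadjoint
    (hadjointC ST).
- by move=> S T _ _ hS hT x; rewrite !fctE hS hT (linopD (unit_linear n)).
- by move=> c T _ hT x; rewrite !fctE hT (linopZ (unit_linear n)).
- by move=> S T _ _ hS hT x; rewrite /= hT hS.
- move=> T CT happ x; apply/eqP; rewrite -subr_eq0; apply/eqP.
  apply: (@rnorm_small _ _ (rnorm (q n x) + rnorm x)) => d d0.
  have [S [CS hS TS]] := happ _ d0.
  have h1 := TS (q n x); have h2 := TS x.
  have h3 := unit_opbound n (T x - S x).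
  rewrite !fctE/= in h1 h2.
  rewrite (linopB (unit_linear n)) -hS mul1r in h3.
  have := ler_rdistD (S (q n x)) (T (q n x)) (q n (T x)).
  rewrite (rdistC (S (q n x))).
  by lra.
Qed.

(** If [T] is the adjoint of [mu S], then [T - T q] is the adjoint of [mu S - q mu S], which equals
    [mu S - mu S q]. For a product, [S T - S T q = S (T - T q)] reduces to the right factor and a
    bound on [S]. *)
Lemma unit_approx T : C T -> forall e : R, 0 < e ->
  exists N, forall n, (N <= n)%N -> opbound e (T - (T \o q n)).
Proof.
move: T; apply: cover_ind.
- move=> S AS e /(E_approx AS)[N hN]; exists N => n /hN h.
  have AS' : A (S - (S \o E n)) by apply: opalgB => //; exact: opalgM.
  rewrite -(alg_homM hmu)// -(alg_homB hA hmu)//; last exact: opalgM.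
  apply: opboundW h _.
  rewrite -(completely_isometric_opnorm (cover_isometric hC))//.
  by apply: opbound_opnorm; apply: (opalg_bounded oC); exact: cover_mem.
- move=> S T AS CT ST e e0; have [N hN] := E_approx AS e0.
  exists N => n /hN h;
  apply: (@opbound_adj _ _ e (mu S - (q n \o mu S)) _ (ltW e0)).
    apply: hadjointB => //; exact: hadjoint_comp (unit_hadjoint n) ST.
  have AS' : A (S - (S \o E n)) by apply: opalgB => //; exact: opalgM.
  rewrite -(alg_homM hmu)// -E_comm// -(alg_homB hA hmu)//; last exact: opalgM.
  apply: opboundW h _.
  rewrite -(completely_isometric_opnorm (cover_isometric hC))//.
  by apply: opbound_opnorm; apply: (opalg_bounded oC); exact: cover_mem.
- move=> S T CS CT hS hT e e0; have e2 : 0 < e / 2 by rewrite divr_gt0.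
  have [N1 h1] := hS _ e2; have [N2 h2] := hT _ e2.
  exists (maxn N1 N2) => n; rewrite geq_max => /andP[/h1 {}h1 /h2 {}h2] x.
  have -> : (S + T - ((S + T) \o q n)) x = (S - (S \o q n)) x + (T - (T \o q n)) x.
    by rewrite !fctE/= opprD addrACA.
  rewrite [e]splitr mulrDl (le_trans (ler_rnormD _ _))//.
  by apply: lerD; [exact: h1|exact: h2].
- move=> c T CT hT e e0.
  have c0 : 0 < rnorm c + 1 by rewrite ltr_wpDl// rnorm_ge0.
  have [N h] := hT _ (divr_gt0 e0 c0); exists N => n /h {}h x.
  have -> : (c *: T - ((c *: T) \o q n)) x = c *: (T - (T \o q n)) x.
    by rewrite !fctE/= scalerBr.
  have := opboundZ c h x; rewrite [(c *: _) x]/(c *: _) => /le_trans; apply.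
  rewrite ler_wpM2r ?rnorm_ge0// mulrCA ger_pMr// ler_pdivrMr// mul1r.
  by rewrite lerDl ler01.
- move=> S T CS CT hS hT e e0.
  have [c c0 hc] := opalg_opbound oC CS.
  have [N h] := hT _ (divr_gt0 e0 c0); exists N => n /h {}h x.
  have -> : ((S \o T) - ((S \o T) \o q n)) x = S ((T - (T \o q n)) x).
    by rewrite !fctE/= (linopB (opalg_linear oC CS)).
  rewrite (le_trans (hc _))// -ler_pdivlMl// mulrA [c^-1 * e]mulrC.
  exact: h.
- move=> T CT happ e e0; have e4 : 0 < e / 4 by rewrite divr_gt0.
  have [S [CS hS TS]] := happ _ e4; have [N h] := hS _ e4.
  exists N => n /h {}h x.
  have h1 := TS x; have h2 := TS (q n x); have h3 := h x.
  have h4 := unit_opbound n x; have h5 := rnorm_ge0 x.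
  have h6 := ler_wpM2l (ltW e4) h4.
  rewrite !fctE/= in h1 h2 h3 *.
  have h7 := ler_rdistD (S x) (T x) (T (q n x)).
  have h8 := ler_rdistD (S (q n x)) (S x) (T (q n x)).
  rewrite (rdistC (S (q n x)) (T _)) in h8.
  have h9 := mulr_ge0 (ltW e0) h5.
  by lra.
Qed.

(** For [x] fixed by [q n], the vector [mu T x = mu (T \o E n) x] is a combination of the finitely
    many [mu (b i) x]. The span of [F] and of these vectors is invariant, since
    [mu T (mu (b i) x) = mu (T \o b i) x] is again of this kind. *)
Lemma finite_invariant_subspace n (F : seq K) :
  (forall x, x \in F -> q n x = x) ->
  exists r (e : 'I_r -> K), [/\ orthonormal_family e,
    forall T, A T -> forall i, span_proj e (mu T (e i)) = mu T (e i) &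
    forall x, x \in F -> span_proj e x = x].
Proof.
move=> qF; have [I [b [Ab bE]]] := E_fin n.
pose s := F ++ [seq mu (b i) x | i <- enum I, x <- F].
have [r [e [he es eQ]]] := gram_schmidt s.
have sF x : x \in F -> x \in s by move=> xF; rewrite mem_cat xF.
have orbit T x : A T -> x \in F -> span_proj e (mu T x) = mu T x.
  move=> AT xF; have [c Tc] := bE _ AT.
  have -> : mu T x = \sum_i c i *: mu (b i) x.
    rewrite -{1}(qF x xF) -[LHS]/((mu T \o mu (E n)) x) -(alg_homM hmu)// Tc.
    rewrite (alg_hom_sum hA hmu)// fct_sumE.
    by [].
  rewrite (linop_sum (proj_linear e)); apply: eq_bigr => i _.
  rewrite (linopZ (proj_linear e)) es// mem_cat; apply/orP; right.
  by apply: (allpairs_f (fun i x => mu (b i) x)) => //; rewrite mem_enum.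
exists r, e; split=> // [T AT i|x /sF/es//].
pose Q v := forall T, A T -> span_proj e (mu T v) = mu T v.
apply: (eQ Q) AT => {T i}.
- move=> T AT; rewrite (linop0 (opalg_linear oC (cover_mem AT))).
  exact: linop0 (proj_linear e).
- move=> a x y Qx Qy T AT; have lT := opalg_linear oC (cover_mem AT).
  by rewrite lT (proj_linear e) Qx// Qy.
- move=> x; rewrite mem_cat => /orP[xF T AT|]; first exact: orbit.
  move=> /allpairsP[[i y] /= [_ yF ->]] T AT.
  rewrite -[mu T _]/((mu T \o mu (b i)) y) -(alg_homM hmu)//.
  by apply: orbit => //; exact: opalgM.
Qed.

(** This is strong convergence of the restrictions, with the net of subspaces replaced by a finite
    set [F] that the span must contain. For a generator [F] holds [x]; for the adjoint of one it
    holds [T x], because [pi T x] is the projection of [T x]. Centrality of [q n] keeps [T x] in the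
    range of [q n]. *)
Lemma restriction_cvg n T : C T -> forall x, q n x = x -> forall d : R, 0 < d ->
  exists2 F : seq K, (forall y, y \in F -> q n y = y) &
    forall r (e : 'I_r -> K) pi, orthonormal_family e ->
      (forall y, y \in F -> span_proj e y = y) ->
      star_hom C (bounded_op K) pi ->
      (forall S, A S -> pi (mu S) = mu S \o span_proj e) ->
      rnorm (pi T x - T x) <= d.
Proof.
move: T; apply: cover_ind.
- move=> S AS x qx d d0; exists [:: x].
    by move=> y; rewrite inE => /eqP ->.
  move=> r e pi he eF hpi hpimu.
  by rewrite hpimu//= eF ?inE// subrr rnorm0 ltW.
- move=> S T AS CT ST x qx d d0; exists [:: T x].
    by move=> y; rewrite inE => /eqP ->; rewrite -unit_comm// qx.
  move=> r e pi he eF hpi hpimu.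
  rewrite (restriction_adj hpi hpimu AS CT ST)/=.
  by rewrite eF ?inE// subrr rnorm0 ltW.
- move=> S T CS CT hS hT x qx d d0; have d2 : 0 < d / 2 by rewrite divr_gt0.
  have [F1 qF1 h1] := hS x qx _ d2; have [F2 qF2 h2] := hT x qx _ d2.
  exists (F1 ++ F2); first by move=> y; rewrite mem_cat => /orP[/qF1|/qF2].
  move=> r e pi he eF hpi hpimu.
  rewrite (alg_homD (star_hom_alg hpi))// !fctE opprD addrACA.
  rewrite (le_trans (ler_rnormD _ _))// [d]splitr lerD//.
    by apply: (h1 r e) => // y yF; apply: eF; rewrite mem_cat yF.
  by apply: (h2 r e) => // y yF; apply: eF; rewrite mem_cat yF orbT.
- move=> c T CT hT x qx d d0.
  have c0 : 0 < rnorm c + 1 by rewrite ltr_wpDl// rnorm_ge0.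
  have [F qF h] := hT x qx _ (divr_gt0 d0 c0); exists F => //.
  move=> r e pi he eF hpi hpimu.
  rewrite (alg_homZ (star_hom_alg hpi))// !fctE -scalerBr rnormZ.
  have := h r e pi he eF hpi hpimu; rewrite ler_pdivlMr// mulrC.
  by apply: le_trans; rewrite ler_wpM2r ?rnorm_ge0// lerDl ler01.
- move=> S T CS CT hS hT x qx d d0; have d2 : 0 < d / 2 by rewrite divr_gt0.
  have qTx : q n (T x) = T x by rewrite -unit_comm// qx.
  have [c c0 hc] := opalg_opbound oC CS.
  (* [2 * c] bounds [pi S] whatever the subspace, so [pi T x] is asked to lie within
     [d / 2 / (2 * c)] of [T x]. *)
  have c2 : 0 < 2 * c by rewrite mulr_gt0.
  have [F1 qF1 h1] := hS _ qTx _ d2.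
  have [F2 qF2 h2] := hT x qx _ (divr_gt0 d2 c2).
  exists (F1 ++ F2); first by move=> y; rewrite mem_cat => /orP[/qF1|/qF2].
  move=> r e pi he eF hpi hpimu.
  rewrite (alg_homM (star_hom_alg hpi))//=.
  rewrite (le_trans (ler_rdistD (pi S (T x)) _ _))// [d]splitr lerD//.
    rewrite -(linopB (star_hom_linear hpi CS)).
    rewrite (le_trans (star_hom_opbound cC hpi CS c0 hc _))//.
    rewrite mulrC -ler_pdivlMr//; apply: (h2 r e) => // y yF; apply: eF.
    by rewrite mem_cat yF orbT.
  by apply: (h1 r e) => // y yF; apply: eF; rewrite mem_cat yF.
- move=> T CT happ x qx d d0.
  (* In units of [d / b], the passage from [pi T x] to [pi S x] costs [2 * rnorm x], from there to
     [S x] costs 1, and on to [T x] costs [rnorm x]. *)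
  pose b := 1 + 3 * rnorm x.
  have b0 : 0 < b by rewrite /b; have := rnorm_ge0 x; lra.
  have db := divr_gt0 d0 b0.
  have [S [CS hS TS]] := happ _ db.
  have [F qF h] := hS x qx _ db; exists F => //.
  move=> r e pi he eF hpi hpimu.
  have h1 := h r e pi he eF hpi hpimu.
  have := star_hom_opbound cC hpi (opalgB oC CT CS) db TS x.
  rewrite (alg_homB oC (star_hom_alg hpi))// => h2.
  have h3 := TS x.
  rewrite !fctE/= in h2 h3.
  have h4 := ler_rdistD (pi S x) (pi T x) (T x).
  have h5 := ler_rdistD (S x) (pi S x) (T x).
  rewrite (rdistC (S x)) in h5.
  have h6 : d = d / b * (1 + 3 * rnorm x) by rewrite mulfVK ?gt_eqF.
  by lra.
Qed.

Lemma cover_rfd : residually_finite_dimensional C.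
Proof.
apply: (separating_rfd cC) => T CT T0.
have [x Tx] : exists x, T x != 0.
  apply: contrapT => h; apply: T0; apply/funext => x; apply: contrapT => Tx.
  by apply: h; exists x; apply/eqP.
have nTx : 0 < rnorm (T x).
  rewrite lt_neqAle rnorm_ge0 andbT eq_sym.
  by apply: contra Tx => /eqP/rnorm_eq0 ->.
have x0 : 0 < rnorm x + 1 by rewrite ltr_wpDl// rnorm_ge0.
(* With this tolerance the error at [x] is strictly below [rnorm (T x)], so [T] does not vanish at
   [q n x]. *)
have [n /(_ n (leqnn n)) hn] := unit_approx CT (divr_gt0 nTx x0).
pose y := q n x.
have qy : q n y = y by rewrite -[LHS]/((q n \o q n) x) unit_idem.
have Ty : 0 < rnorm (T y).
  rewrite lt_neqAle rnorm_ge0 andbT eq_sym; apply/eqP => /rnorm_eq0 Ty0.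
  have := hn x; rewrite !fctE/= -/y Ty0 subr0 mulrAC ler_pdivlMr//.
  by rewrite leNgt ltr_pM2l// ltrDl ltr01.
have [F qF hF] := restriction_cvg CT qy (divr_gt0 Ty (ltr0n R 2)).
(* [y] joins [F] so that the span contains it and the matrix of [pi T] can detect [pi T y]. *)
have yF z : z \in y :: F -> q n z = z.
  by rewrite inE => /predU1P[->|/qF].
have [r [e [he einv eF]]] := finite_invariant_subspace yF.
have [pi hpi hpimu] := restriction_extends he einv.
have piy : pi T y != 0.
  apply/eqP => piy0.
  have : rnorm (pi T y - T y) <= rnorm (T y) / 2.
    by apply: (hF r e) => // z zF; apply: eF; rewrite inE zF orbT.
  by rewrite piy0 sub0r rnormN; lra.
have ey : span_proj e y = y by apply: eF; rewrite inE eqxx.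
have lpi S (CS : C S) : linear (pi S) := star_hom_linear hpi CS.
have inv S j : C S -> span_proj e (pi S (e j)) = pi S (e j).
  by move=> CS; rewrite -(proj_basis he j) (star_hom_invariant he einv hpi hpimu).
(* Size 0 is excluded: the span would be zero, yet it contains [y], and [pi T y] is nonzero. *)
case: r => [|r] in e he einv eF hpimu ey inv *.
  move: piy; rewrite -ey /span_proj big_ord0 (linop0 (lpi _ CT)) eqxx//.
have api := star_hom_alg hpi.
exists r, (fun S => compress e (pi S)); split.
  split; last first.
    move=> S c CS c0 hc; apply: compress_norm => //; first exact: lpi.
      by rewrite mulr_ge0// ltW.
    exact: (star_hom_opbound cC hpi CS c0 hc).
  split=> [S CS|S S' CS CS' _|c S CS _|S S' CS CS' _|S S' CS CS' SS' _].
  - have [c c0 hc] := opalg_opbound oC CS; exists (2 * c) => _.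
    apply: compress_norm => //; first exact: lpi.
      by rewrite mulr_ge0// ltW.
    exact: (star_hom_opbound cC hpi CS c0 hc).
  - by rewrite (alg_homD api)// compressD.
  - by rewrite (alg_homZ api)// compressZ.
  - rewrite (alg_homM api)// compressM//; first exact: lpi.
    by move=> j; exact: inv.
  - by apply: compress_adj; exact: (star_hom_adj hpi CS CS' SS').
move=> M0; move/eqP : piy; apply.
(* Zero entries make the projection of each [pi T (e j)] vanish, and by invariance that projection
   is [pi T (e j)] itself; expanding [y] in [e] gives [pi T y = 0]. *)
rewrite -ey [X in pi T X]/span_proj (linop_sum (lpi _ CT)) big1// => j _.
rewrite (linopZ (lpi _ CT)) -inv// [X in _ *: X]/span_proj big1 ?scaler0// => i _.
have /matrixP/(_ i j) := M0; rewrite !mxE => ->.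
by rewrite scale0r.
Qed.

End CentralApproximateUnit.

End MaximalCover.

(** * Truncations in a c_0-direct sum *)

Section C0Sum.
Variables (R : realType) (H_ : nat -> hilbertType R).
Variable A_ : forall n, set (H_ n -> H_ n).
Arguments A_ : clear implicits.
Hypotheses (hA_ : forall n, operator_algebra (A_ n))
  (hA_unital : forall n, unital_opalg (A_ n))
  (hA_fd : forall n, finite_dimensional (A_ n)).

Lemma l2_rnorm_le (x y : l2sum H_) (c : R) : 0 <= c ->
  (forall n, rnorm (y n) <= c * rnorm (x n)) -> rnorm y <= c * rnorm x.
Proof.
move=> c0 h; rewrite -(@ler_pXn2r _ 2)// ?nnegrE ?mulr_ge0 ?rnorm_ge0//.
rewrite l2_rnorm_sq; apply: limr_le; first exact: l2valP.
apply: nearW => N; rewrite seriesEnat/= exprMn.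
apply: (@le_trans _ _ (c ^+ 2 * \sum_(0 <= n < N) rnorm (x n) ^+ 2)).
  rewrite mulr_sumr; apply: ler_sum => n _.
  by rewrite -exprMn lerXn2r ?nnegrE ?mulr_ge0 ?rnorm_ge0.
by rewrite ler_wpM2l ?sqr_ge0// l2_rnorm_sq l2_partial_le.
Qed.

Lemma l2_sumE (I : finType) (f : I -> l2sum H_) n :
  (\sum_i f i) n = \sum_i f i n.
Proof.
by apply: (big_morph (fun x : l2sum H_ => x n)) => // x y; rewrite l2_addE.
Qed.

Lemma finite_diag (a : forall n, H_ n -> H_ n) N :
  (forall n, A_ n (a n)) -> (forall n, (N <= n)%N -> a n = 0) ->
  exists2 T, c0_sum A_ T & forall x n, T x n = a n (x n).
Proof.
move=> Aa a0.
have cvg x : cvgn (series (fun n => rnorm (a n (x n)) ^+ 2)).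
  apply/cvg_ex; exists (series (fun n => rnorm (a n (x n)) ^+ 2) N).
  apply: cvg_near_cst; exists N => // n /= Nn.
  rewrite !seriesEnat/= (big_cat_nat _ Nn)//= [X in _ + X]big_nat_cond.
  rewrite [X in _ + X]big1 ?addr0// => k /andP[/andP[Nk _] _].
  by rewrite a0// [rnorm _]rnorm0 expr0n.
exists (fun x : l2sum H_ => L2Sum (cvg x)) => //.
exists a; split=> //; apply: cvg_near_cst; exists N => // n /= Nn.
by rewrite a0// opnorm0.
Qed.

Lemma c0_trunc_ex N : exists2 T, c0_sum A_ T &
  forall (x : l2sum H_) n, T x n = if (n < N)%N then x n else 0.
Proof.
have [|n Nn|T AT TE] := @finite_diag (fun n => if (n < N)%N then idfun else 0) N.
- by move=> n; case: ifP => _; [exact: hA_unital|exact: opalg0].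
- by rewrite ltnNge Nn.
- by exists T => // x n; rewrite TE; case: ifP.
Qed.

(** The unit of the sum of the blocks with index below [N], hence zero for [N = 0]. *)
Definition c0_trunc N : l2sum H_ -> l2sum H_ := sval (cid2 (c0_trunc_ex N)).

Lemma c0_truncP N : c0_sum A_ (c0_trunc N).
Proof. by rewrite /c0_trunc; case: cid2. Qed.

Lemma c0_truncE N (x : l2sum H_) n :
  c0_trunc N x n = if (n < N)%N then x n else 0.
Proof. by rewrite /c0_trunc; case: cid2. Qed.

Lemma c0_trunc_idem N : c0_trunc N \o c0_trunc N = c0_trunc N.
Proof.
apply/funext => x; apply: l2sum_ext => n /=; rewrite !c0_truncE.
by case: (n < N)%N.
Qed.

Lemma c0_trunc_opnorm N : opnorm (c0_trunc N) <= 1.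
Proof.
apply: opnorm_le => // x; apply: l2_rnorm_le => // n; rewrite mul1r c0_truncE.
by case: ifP => // _; rewrite rnorm0 rnorm_ge0.
Qed.

Lemma c0_trunc_comm N T : c0_sum A_ T -> T \o c0_trunc N = c0_trunc N \o T.
Proof.
move=> [a [Aa _ Ta]]; apply/funext => x; apply: l2sum_ext => n /=.
rewrite c0_truncE !Ta c0_truncE; case: ifP => // _.
exact: linop0 (opalg_linear (hA_ n) (Aa n)).
Qed.

(** What truncation leaves out is diagonal, with the blocks [a n] past the cut, and these all have
    norm below [e] once the cut is late enough. *)
Lemma c0_trunc_approx T (e : R) : c0_sum A_ T -> 0 < e ->
  exists N, forall n, (N <= n)%N -> opnorm (T - (T \o c0_trunc n)) <= e.
Proof.
move=> [a [Aa /cvgrPdist_lt/(_ e) a0 Ta]] e0; have [N _ hN] := a0 e0.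
exists N => m Nm; apply: opnorm_le; first exact: ltW.
move=> x; apply: l2_rnorm_le => [|n]; first exact: ltW.
have ba := opalg_bounded (hA_ n) (Aa n).
rewrite [(_ - _ : _ -> _) x]/(T x - T (c0_trunc m x)) l2_addE l2_oppE.
rewrite !Ta c0_truncE; case: ltnP => mn; first by rewrite subrr rnorm0 mulr_ge0 ?rnorm_ge0// ltW.
rewrite (linop0 ba.1) subr0; apply: opboundW (opbound_opnorm ba) _.
have := hN n (leq_trans Nm mn); rewrite /= sub0r normrN => /ltW.
exact: le_trans (ler_norm _).
Qed.

(** By induction on [N]: the family for [N] is enlarged by a spanning family of [A_ N], placed in
    block [N] with zeros elsewhere. *)
Lemma c0_trunc_fin N : exists (I : finType) (b : I -> l2sum H_ -> l2sum H_),
  (forall i, c0_sum A_ (b i)) /\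
  forall T, c0_sum A_ T ->
    exists c : I -> R[i], T \o c0_trunc N = \sum_i c i *: b i.
Proof.
elim: N => [|N [I [b [Ab bE]]]].
  exists void, (fun=> 0); split=> [[]|T [a [Aa _ Ta]]].
  exists (fun=> 0); rewrite big1; last by case.
  apply/funext => x; apply: l2sum_ext => n; rewrite /= Ta c0_truncE.
  exact: linop0 (opalg_linear (hA_ n) (Aa n)).
have [d [u [Au uE]]] := hA_fd N.
have /choice[v hv] i : exists T, c0_sum A_ T /\ forall x n,
    T x n = dfwith (fun n => 0 : H_ n -> H_ n) N (u i) n (x n).
  have [|n|T] := @finite_diag (dfwith (fun n => 0 : H_ n -> H_ n) N (u i)) N.+1.
  - by move=> n; case: dfwithP => [|j _]; [exact: Au|exact: opalg0].
  - by move=> Nn; rewrite dfwithout// neq_ltn Nn.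
  - by exists T.
exists (I + 'I_d)%type, (fun p => match p with inl i => b i | inr i => v i end).
split=> [[i|i]|T AT]; [exact: Ab|by have [] := hv i|].
have [c cE] := bE _ AT; have [a [Aa _ Ta]] := AT.
have [c' c'E] := uE _ (Aa N).
exists (fun p => match p with inl i => c i | inr i => c' i end).
rewrite big_sumType/= -cE; apply/funext => x; apply: l2sum_ext => n.
rewrite -[RHS]/((T (c0_trunc N x) + (\sum_i c' i *: v i) x) n) l2_addE.
rewrite /= !Ta !c0_truncE fct_sumE l2_sumE.
have a0 := linop0 (opalg_linear (hA_ n) (Aa n)).
under eq_bigr => i _.
  rewrite -[(_ *: v i) x]/(c' i *: v i x) l2_scaleE (hv i).2; over.
(* In block [N] the truncation at [N] vanishes and the [v i] contribute; in every other block the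
   [v i] vanish and the truncations at [N] and [N.+1] agree. *)
have [<-|nN] := eqVneq N n.
  rewrite ltnSn ltnn (linop0 (opalg_linear (hA_ N) (Aa N))) add0r c'E fct_sumE.
  by apply: eq_bigr => i _; rewrite dfwithin.
rewrite big1 ?addr0 => [|i _]; last by rewrite dfwithout// scaler0.
by rewrite ltnS leq_eqVlt eq_sym (negbTE nN).
Qed.

End C0Sum.

(** * Transport to an algebra isomorphic to a c_0-direct sum *)

Theorem corollary5p3 (R : realType)
    (H : hilbertType R) (A : set (H -> H))
    (H_ : nat -> hilbertType R) (A_ : forall n, set (H_ n -> H_ n))
    (hA : operator_algebra A)
    (hA_ : forall n, operator_algebra (A_ n))
    (hA_unital : forall n, unital_opalg (A_ n))
    (hA_fd : forall n, finite_dimensional (A_ n))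
    (hsum : completely_isometrically_isomorphic A (c0_sum A_))
    (K : hilbertType R) (C : set (K -> K)) (mu : (H -> H) -> (K -> K))
    (hC : maximal_cstar_cover A mu C) :
  residually_finite_dimensional C.
Proof.
have [phi [hphi iso im]] := hsum.
pose D := c0_trunc hA_ hA_unital.
(* [phi] maps [A] onto [c0_sum A_], so the truncations have preimages [E n]; injectivity and
   isometry of [phi] then carry their properties back to [A]. *)
have /choice[E hE] n : exists S, A S /\ phi S = D n.
  have : (phi @` A) (D n) by rewrite im; exact: c0_truncP.
  by move=> [S AS <-]; exists S.
have AE n : A (E n) := (hE n).1.
have phiE n : phi (E n) = D n := (hE n).2.
have phiA T : A T -> c0_sum A_ (phi T) by move=> AT; rewrite -im; exists T.
have inj := completely_isometric_inj hA hphi iso.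
have AM := opalgM hA.
apply: (@cover_rfd _ _ _ _ _ _ hA hC E) => // [n|n|n T AT|T AT e e0|n].
- apply: inj; [exact: AM|exact: AE|].
  by rewrite (alg_homM hphi (AE n) (AE n)) phiE c0_trunc_idem.
- by rewrite -(completely_isometric_opnorm iso (AE n)) phiE c0_trunc_opnorm.
- apply: inj; [exact: AM|exact: AM|].
  rewrite (alg_homM hphi AT (AE n)) (alg_homM hphi (AE n) AT) phiE.
  by rewrite c0_trunc_comm//; exact: phiA.
- have [N hN] := c0_trunc_approx hA_ hA_unital (phiA _ AT) e0.
  exists N => n /hN; rewrite -/(D n) -phiE -(alg_homM hphi AT (AE n)).
  have ATE : A (T \o E n) by exact: AM.
  rewrite -(alg_homB hA hphi AT ATE) (completely_isometric_opnorm iso)//.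
  exact: opalgB.
- have [I [b [Ab bE]]] := c0_trunc_fin hA_ hA_unital hA_fd n.
  have /choice[b' hb'] i : exists S, A S /\ phi S = b i.
    have : (phi @` A) (b i) by rewrite im; exact: Ab.
    by move=> [S AS <-]; exists S.
  have Ab' i : A (b' i) := (hb' i).1.
  exists I, b'; split=> // T AT; have [c cE] := bE _ (phiA _ AT).
  exists c; apply: inj; [exact: AM|exact: opalg_sum|].
  rewrite (alg_homM hphi AT (AE n)) phiE cE (alg_hom_sum hA hphi)//.
  by apply: eq_bigr => i _; rewrite (hb' i).2.
Qed.
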